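(* Assume that $\mathbb{P}_3=\times_{n\in I}q_n$ is such that $q_{n_0}$ is a continuous measure for some $n_0\in I$. Let $E\in\mathbb{R}$ be fixed, let $$P(E):=\{(\Lambda,R,\Theta)\in\Omega_1\times\Omega_2\times\Omega_3: E\in\sigma_p(H_{\Lambda,R,\Theta})\},$$ and suppose that $P(E)$ is measurable. Let $\mathbb{P}=\mathbb{P}_1\times\mathbb{P}_2\times\mathbb{P}_3$. Then $\mathbb{P}(P(E))=0$.
   Context: Let $-\infty\le a<b\le\infty$, $V\in L^1_{\mathrm{loc}}(a,b)$ real-valued, $\tau f:=-f''+Vf$, and let $M=\{x_n\}_{n\in I}\subset(a,b)$, $I\subseteq\mathbb{Z}$, be a fixed discrete set of (distinct) points accumulating at most at $a$ or $b$. For $\Lambda=\{\alpha_n\}_{n\in I}\in\mathbb{R}^I$, $R=\{r_n\}_{n\in I}\in(0,\infty)^I$, $\Theta=\{\theta_n\}_{n\in I}\in\mathbb{R}^I$, set $$A_{\alpha_n,r_n,\theta_n}:=\begin{pmatrix}1&\alpha_n\\0&1\end{pmatrix}\begin{pmatrix}r_n&0\\0&1/r_n\end{pmatrix}\begin{pmatrix}\cos\theta_n&-\sin\theta_n\\ \sin\theta_n&\cos\theta_n\end{pmatrix}.$$ Interface conditions: $(f(x_n+),f'(x_n+))^T=A_{\alpha_n,r_n,\theta_n}(f(x_n-),f'(x_n-))^T$ for all $n\in I$. For $z\in\mathbb{C}$, a solution of $(\tau_{\Lambda,R,\Theta}-z)f=0$ is a function $f$ with $f,f'$ (locally) absolutely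 continuous in $(a,b)\setminus M$, $-f''+Vf-zf=0$, satisfying the interface conditions. $\tau_{\Lambda,R,\Theta}$ is in the limit point case at $a$ (resp. $b$) if for every $z\in\mathbb{C}$ at least one solution of $(\tau_{\Lambda,R,\Theta}-z)f=0$ is not square integrable near $a$ (resp. $b$). It is regular at $a$ if $a$ is finite, $V\in L^1_{\mathrm{loc}}[a,b)$ and $a$ is not an accumulation point of $M$; analogously at $b$. Standing assumption: at $a$, either $\tau_{\Lambda,R,\Theta}$ is regular or it is in the limit point case (for all parameter sequences considered), and likewise at $b$. The selfadjoint operator $H_{\Lambda,R,\Theta}$ in $L^2(a,b)$ acts as $H_{\Lambda,R,\Theta}f=\tau f$ on the domain of all $f\in L^2(a,b)$ such that $f,f'$ are (locally) absolutely continuous in $(a,b)\setminus M$, $-f''+Vf\in L^2(a,b)$, the interface conditions hold, and, at each regular endpoint, a fixed boundary condition holds: $f(a)\cos\psi_a+f'(a)\sin\psi_a=0$ if regular at $a$, and $f(b)\cos\psi_b+f'(b)\sin\psi_b=0$ if regular at $b$, with fixed $\psi_a,\psi_b\in[0,\pi)$ (no condition at a limit point endpoint). $\sigma_p$ denotes the set of eigenvalues. Probability spaces: $\Omega_1=(\mathbb{R}^I,\mathcal{F}_1,\mathbb{P}_1)$, $\Omega_2=((0,\infty)^I,\mathcal{F}_2,\mathbb{P}_2)$, $\Omega_3=(\mathbb{R}^I,\mathcal{F}_3,\mathbb{P}_3)$, where each $\mathbb{P}_j$ is a product over $n\in I$ of Borel probability measures (on $\mathbb{R}$, $(0,\infty)$,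 $\mathbb{R}$ respectively), defined on the product $\sigma$-algebra $\mathcal{F}_j$ generated by cylinder sets; $q_n$ are the factors of $\mathbb{P}_3$. Measurability of $P(E)$ is with respect to the product $\sigma$-algebra on $\Omega_1\times\Omega_2\times\Omega_3$. A measure is continuous if it gives measure zero to every single point. *)

(* Defs.v *)
From HB Require Import structures.
From mathcomp Require Import all_boot all_order all_algebra.
From mathcomp Require Import complex.
From mathcomp Require Import all_classical all_reals all_analysis.

Set Implicit Arguments.
Unset Strict Implicit.
Unset Printing Implicit Defensive.

Import Order.TTheory GRing.Theory Num.Theory.
Import numFieldNormedType.Exports.

Local Open Scope classical_set_scope.
Local Open Scope ring_scope.
Local Open Scope complex_scope.

(* Functions on (a, b) are total functions on R, only whose values on (a, b)
   matter. Complex-valued functions of a real variable are differentiated,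
   integrated, and have limits taken, componentwise. *)

Definition absolutely_continuous_on (R : realType) (c d : R) (f : R -> R) : Prop :=
  forall e : R, 0 < e -> exists2 del : R, 0 < del &
    forall (n : nat) (u v : 'I_n -> R),
      (forall i, [/\ c <= u i, u i <= v i & v i <= d]) ->
      trivIset [set: 'I_n] (fun i => `]u i, v i[%classic) ->
      \sum_(i < n) (v i - u i) < del ->
      \sum_(i < n) `|f (v i) - f (u i)| < e.

Definition locally_absolutely_continuous (R : realType) (U : set R) (f : R -> R[i]) : Prop :=
  forall c d : R, c <= d -> `[c, d]%classic `<=` U ->
    absolutely_continuous_on c d (fun t => complex.Re (f t)) /\
    absolutely_continuous_on c d (fun t => complex.Im (f t)).

Definition cderivable (R : realType) (f : R -> R[i]) (t : R) : Prop :=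
  derivable (fun s => complex.Re (f s)) t 1 /\
  derivable (fun s => complex.Im (f s)) t 1.

Definition cderive (R : realType) (f : R -> R[i]) (t : R) : R[i] :=
  derive1 (fun s => complex.Re (f s)) t +i* derive1 (fun s => complex.Im (f s)) t.

Definition climit (R : realType) (f : R -> R[i]) (F : set_system R) (l : R[i]) : Prop :=
  (complex.Re (f t) @[t --> F] --> complex.Re l) /\
  (complex.Im (f t) @[t --> F] --> complex.Im l).

Definition square_integrable (R : realType) (D : set R) (f : R -> R[i]) : Prop :=
  [/\ measurable_fun D (fun t => complex.Re (f t)),
      measurable_fun D (fun t => complex.Im (f t)) &
      (@lebesgue_measure R).-integrable D
        (fun t => (complex.Re (f t) ^+ 2 + complex.Im (f t) ^+ 2)%:E)].

Definition ae_eq_on (R : realType) (D : set R) (f g : R -> R[i]) : Prop :=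
  {ae @lebesgue_measure R, forall t, D t -> f t = g t}.

Definition oint (R : realType) (a b : \bar R) : set R :=
  [set t : R | (a < t%:E)%E /\ (t%:E < b)%E].

(* The second derivative exists only almost everywhere, so tau f is only
   meaningful up to a null set. *)
Definition tau (R : realType) (V : R -> R) (f : R -> R[i]) (t : R) : R[i] :=
  - cderive (cderive f) t + (V t)%:C * f t.

Definition mx22 (T : Type) (p q r s : T) : 'M[T]_2 :=
  \matrix_(i < 2, j < 2)
    if i == 0 :> nat then (if j == 0 :> nat then p else q)
    else (if j == 0 :> nat then r else s).

Definition col2 (T : Type) (p q : T) : 'cV[T]_2 :=
  \col_(i < 2) if i == 0 :> nat then p else q.

Definition interface_mx (R : realType) (alpha r theta : R) : 'M[R]_2 :=
  mx22 1 alpha 0 1 *m mx22 r 0 0 (1 / r)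
  *m mx22 (cos theta) (- sin theta) (sin theta) (cos theta).

Section PointInteractions.
Context (R : realType) (a b : \bar R) (V : R -> R) (I : set int) (x : I -> R).
Implicit Types (Lambda Theta : I -> R) (Rho : I -> {posnum R}) (f : R -> R[i]).

Definition admissible_points : Prop :=
  [/\ injective x,
      (forall n, oint a b (x n)) &
      (forall t, oint a b t -> ~ limit_point (range x) t)].

Definition interface_conditions Lambda Rho Theta f : Prop :=
  forall n : I, exists fl dfl fr dfr : R[i],
    [/\ climit f (x n)^'- fl, climit (cderive f) (x n)^'- dfl,
        climit f (x n)^'+ fr, climit (cderive f) (x n)^'+ dfr &
        col2 fr dfr =
          map_mx (real_complex R) (interface_mx (Lambda n) (Rho n)%:num (Theta n))
          *m col2 fl dfl].

Definition piecewise_ac f : Prop :=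
  let U := oint a b `\` range x in
  [/\ (forall t, U t -> cderivable f t),
      locally_absolutely_continuous U f &
      locally_absolutely_continuous U (cderive f)].

Definition solution Lambda Rho Theta (z : R[i]) f : Prop :=
  [/\ piecewise_ac f,
      ae_eq_on (oint a b) (fun t => tau V f t - z * f t) (fun=> 0) &
      interface_conditions Lambda Rho Theta f].

Definition square_integrable_near_left f : Prop :=
  exists2 c : R, oint a b c & square_integrable (oint a c%:E) f.

Definition square_integrable_near_right f : Prop :=
  exists2 c : R, oint a b c & square_integrable (oint c%:E b) f.

Definition limit_point_case_left Lambda Rho Theta : Prop :=
  forall z : R[i], exists2 f, solution Lambda Rho Theta z f &
    ~ square_integrable_near_left f.

Definition limit_point_case_right Lambda Rho Theta : Prop :=
  forall z : R[i], exists2 f, solution Lambda Rho Theta z f &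
    ~ square_integrable_near_right f.

(* Regularity does not depend on the parameters. *)
Definition regular_left : Prop :=
  [/\ a \is a fin_num,
      (forall c : R, oint a b c ->
         (@lebesgue_measure R).-integrable (oint a c%:E) (fun t => (V t)%:E)) &
      ~ limit_point (range x) (fine a)].

Definition regular_right : Prop :=
  [/\ b \is a fin_num,
      (forall c : R, oint a b c ->
         (@lebesgue_measure R).-integrable (oint c%:E b) (fun t => (V t)%:E)) &
      ~ limit_point (range x) (fine b)].

(* f and f' have finite limits at a regular endpoint; these are f(a), f'(a). *)
Definition boundary_condition (F : set_system R) (psi : R) f : Prop :=
  exists f0 df0 : R[i],
    [/\ climit f F f0, climit (cderive f) F df0 &
        f0 * (cos psi)%:C + df0 * (sin psi)%:C = 0].

Definition H_domain (psia psib : R) Lambda Rho Theta f : Prop :=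
  [/\ square_integrable (oint a b) f,
      piecewise_ac f,
      (exists2 g, square_integrable (oint a b) g &
         ae_eq_on (oint a b) (tau V f) g),
      interface_conditions Lambda Rho Theta f &
      (regular_left -> boundary_condition (fine a)^'+ psia f) /\
      (regular_right -> boundary_condition (fine b)^'- psib f)].

(* Eigenvalues: H f = z f for some f in the domain with f <> 0 in L^2(a, b). *)
Definition H_point_spectrum (psia psib : R) Lambda Rho Theta : set R[i] :=
  [set z | exists f,
     [/\ H_domain psia psib Lambda Rho Theta f,
         ~ ae_eq_on (oint a b) f (fun=> 0) &
         ae_eq_on (oint a b) (tau V f) (fun t => z * f t)]].

End PointInteractions.

(* T^I with the sigma-algebra generated by the coordinate maps. *)
Definition coordinate_sets (I : Type) d (T : measurableType d) : set (set (I -> T)) :=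
  [set A | exists i : I, exists2 B : set T, measurable B & A = [set w | B (w i)]].

Definition sequence_space (I : Type) d (T : measurableType d) :=
  g_sigma_algebraType (@coordinate_sets I d T).

Definition posreal (R : realType) : Type := {posnum R}.
HB.instance Definition _ (R : realType) := Choice.copy (posreal R) {posnum R}.
HB.instance Definition _ (R : realType) :=
  isPointed.Build (posreal R) (1%:pos : {posnum R}).

(* (0, +oo) with its Borel sigma-algebra. *)
Definition positive_reals (R : realType) :=
  g_sigma_algebra_preimageType
    (fun r : posreal R => (r : {posnum R})%:num : measurableTypeR R).

(* P is the product of the p i; its values on measurable boxes with finitely
   many constrained coordinates determine it. *)
Definition is_product_probability (R : realType) (I : choiceType) d
    (T : measurableType d) (p : I -> probability T R)
    (P : probability (sequence_space I T) R) : Prop :=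
  forall (J : seq I) (B : I -> set T),
    uniq J -> (forall i, measurable (B i)) ->
    P [set w | forall i, i \in J -> B i (w i)] = (\prod_(i <- J) p i (B i))%E.

Definition continuous_measure (R : realType) (q : probability (measurableTypeR R) R) : Prop :=
  forall t : R, q [set t] = 0%E.

(* Main.v *)
Require Import Defs.
From HB Require Import structures.
From mathcomp Require Import all_boot all_order all_algebra.
From mathcomp Require Import complex.
From mathcomp Require Import all_classical all_reals all_analysis.
From mathcomp Require Import measurable_realfun.
From mathcomp Require Import ring lra.

Set Implicit Arguments.
Unset Strict Implicit.
Unset Printing Implicit Defensive.

Import Order.TTheory GRing.Theory Num.Theory.
Import numFieldNormedType.Exports.

Local Open Scope classical_set_scope.
Local Open Scope ring_scope.
Local Open Scope complex_scope.

(** Fix all parameters except the angle at the interface n0 whose law is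
    continuous. Suppose that E is an eigenvalue for two values theta1, theta2 of
    this angle, with eigenfunctions f1, f2; as E and the interface matrices are
    real, both may be taken real.

    To the left of x n0 both functions solve the same problem. Their Wronskian is
    constant there, because the interface matrices have determinant one, and it
    vanishes: at a regular endpoint by the common boundary condition, and in the
    limit point case because two square integrable solutions with nonzero
    Wronskian would make every solution square integrable. The same holds to the
    right. Hence the left limits of (f1, f1') and (f2, f2') at x n0 are parallel,
    and so are the right limits. None of these vectors is zero, by uniqueness for
    the initial value problem. The right limits are images of the left ones under
    matrices differing only by the rotation, so a rotation by theta2 - theta1
    preserves a real line: sin (theta2 - theta1) = 0 (eigenvalue_angle). For given
    other parameters the exceptional angles thus form a countable set, which is
    null for a continuous law. Since resampling one coordinate independently does
    not change a product law (resample_law), Fubini's theorem gives the result.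

    The analytic input is the fundamental theorem of calculus for absolutely
    continuous functions (absolutely_continuous_FTC). The equation only prescribes
    the value of derive1 (derive1 f) almost everywhere, and derive1 has a value
    even where the derivative does not exist, so the almost everywhere
    differentiability of derive1 f has to be proved. An absolutely continuous function is
    a difference of two nondecreasing absolutely continuous ones; the
    Lebesgue-Stieltjes measure of such a function is dominated by the Lebesgue
    measure, so that the Radon-Nikodym and Lebesgue differentiation theorems
    apply. The constancy of the Wronskian (wronskian_constant) and the uniqueness
    theorem, in the form of a two-sided Gronwall bound for f^2 + f'^2
    (energy_comparable), follow. *)

(** * Absolutely continuous functions *)

Section AbsoluteContinuity.
Context (R : realType).
Implicit Types (c d : R) (F : R -> R) (L : seq (R * R)).

(** A finite list of intervals, given by their endpoints, no two of which overlap;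
    common endpoints and degenerate intervals are allowed. *)
Definition nonoverlapping L : bool :=
  all (fun p => p.1 <= p.2) L &&
  pairwise (fun p q => (p.2 <= q.1) || (q.2 <= p.1)) L.

Definition total_length L : R := \sum_(p <- L) (p.2 - p.1).

(** Absolute continuity on the whole line, with one modulus, in terms of lists of
    intervals, which can be concatenated and refined. *)
Definition uniformly_ac F : Prop :=
  forall e, 0 < e -> exists2 del, 0 < del &
    forall L, nonoverlapping L -> total_length L < del ->
      \sum_(p <- L) `|F p.2 - F p.1| < e.

(** The nearest point of [c, d]. Precomposing with it extends a function on
    [c, d] by constants. *)
Definition clamp c d t : R := Num.max c (Num.min d t).

Lemma clamp_in c d t : c <= d -> c <= clamp c d t <= d.
Proof.
by move=> cd; rewrite /clamp le_max lexx /= ge_max cd /= ge_min lexx.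
Qed.

Lemma clamp_id c d t : c <= t <= d -> clamp c d t = t.
Proof. by move=> /andP[ct td]; rewrite /clamp (min_idPr td) (max_idPr ct). Qed.

Lemma clamp_le c d s t : s <= t -> clamp c d s <= clamp c d t.
Proof.
move=> st; rewrite /clamp ge_max le_max lexx /= le_max.
by apply/orP; right; rewrite le_min !ge_min lexx st /= orbT.
Qed.

Lemma clamp_lipschitz c d s t : s <= t ->
  clamp c d t - clamp c d s <= t - s.
Proof.
move=> st; rewrite /clamp !maxEle !minEle.
by case: (leP d t); case: (leP d s); do ?case: ifP; lra.
Qed.

Lemma uniformly_ac_clamp c d F : c <= d -> absolutely_continuous_on c d F ->
  uniformly_ac (F \o clamp c d).
Proof.
move=> cd acF e e0; have [del del0 H] := acF e e0; exists del => // L.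
move=> /andP[/allP ord dis] len.
pose K (i : 'I_(size L)) := nth (0, 0) L i.
have -> : \sum_(p <- L) `|(F \o clamp c d) p.2 - (F \o clamp c d) p.1| =
    \sum_(i < size L) `|F (clamp c d (K i).2) - F (clamp c d (K i).1)|.
  by rewrite (big_nth (0, 0)) big_mkord.
have Kord i : (K i).1 <= (K i).2 by apply/ord/mem_nth.
apply: H.
- move=> i; split; [|exact: clamp_le|].
  + by have /andP[] := clamp_in (K i).1 cd.
  + by have /andP[] := clamp_in (K i).2 cd.
- have dis' (i j : 'I_(size L)) : (i < j)%N ->
      `](clamp c d (K i).1), (clamp c d (K i).2)[ `&`
      `](clamp c d (K j).1), (clamp c d (K j).2)[ = set0.
    move=> ij; apply/seteqP; split => // t [].
    have /(pairwiseP (0, 0)) /(_ i j) := dis.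
    rewrite !inE !ltn_ord => /(_ isT isT ij) /=.
    rewrite -/(K i) -/(K j) => /orP[] /(clamp_le c d) h;
      rewrite !in_itv /= => /andP[? ?] /andP[? ?].
      by exfalso; lra.
    by exfalso; lra.
  apply/trivIsetP => i j _ _; rewrite neq_ltn => /orP[] ij; first exact: dis'.
  by rewrite setIC; exact: dis'.
- apply: le_lt_trans len; rewrite /total_length (big_nth (0, 0)) big_mkord.
  by apply: ler_sum => i _; exact: clamp_lipschitz.
Qed.

Lemma total_length_cons p L : total_length (p :: L) = p.2 - p.1 + total_length L.
Proof. by rewrite /total_length big_cons. Qed.

Lemma total_length_cat L1 L2 :
  total_length (L1 ++ L2) = total_length L1 + total_length L2.
Proof. by rewrite /total_length big_cat. Qed.

(** The consecutive pairs of a partition form a list of nonoverlapping intervals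
    whose increments sum up to the variation. *)
Lemma itv_partition_pairs c d F s : itv_partition c d s ->
  [/\ nonoverlapping (zip (c :: s) s),
      all (fun p => (c <= p.1) && (p.2 <= d)) (zip (c :: s) s),
      total_length (zip (c :: s) s) = d - c &
      variation c d F s = \sum_(p <- zip (c :: s) s) `|F p.2 - F p.1|].
Proof.
elim: s c => [|h s ih] c.
  by move=> /itv_partition_nil ->; rewrite /nonoverlapping /total_length /variation !big_nil /= subrr.
move=> [/= /andP[ch hs] ld]; have hd : itv_partition h d s by [].
have [/andP[ord dis] sub len var] := ih _ hd.
have hled : h <= d by rewrite (itv_partition_le hd).
split.
- rewrite /nonoverlapping /= (ltW ch) ord dis andbT /=.
  by rewrite andbT; apply: sub_all sub => p /andP[->].
- rewrite /= lexx hled /=; apply: sub_all sub => p /andP[hp ->].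
  by rewrite (le_trans (ltW ch)).
- by rewrite [zip _ _]/= total_length_cons len /=; lra.
- by rewrite big_cons -var /variation /= big_nat_recl.
Qed.

(** In the definition of absolute continuity the increments may be replaced by
    the total variations. *)
Lemma uniformly_ac_total_variation_le F e : uniformly_ac F -> 0 < e ->
  exists2 del, 0 < del &
    forall L, nonoverlapping L -> total_length L < del ->
      (\sum_(p <- L) total_variation p.1 p.2 F <= e%:E)%E.
Proof.
move=> acF e0; have [del del0 H] := acF e e0; exists del => // L noL lenL.
(* Replace the increments by total variations one interval at a time, refining
   the interval by an arbitrary partition and taking the supremum. *)
suff S : forall L1 L2, nonoverlapping (L1 ++ L2) -> total_length (L1 ++ L2) < del ->
    (\sum_(p <- L1) total_variation p.1 p.2 F +
      (\sum_(p <- L2) `|F p.2 - F p.1|)%:E <= e%:E)%E.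
  have := S L [::]; rewrite cats0 => /(_ noL lenL).
  by rewrite big_nil adde0.
elim=> [|p L1 ih] L2.
  by move=> no len; rewrite big_nil add0e lee_fin ltW// H.
rewrite cat_cons /nonoverlapping /= => /andP[/andP[ordp ord] /andP[disp dis]].
rewrite total_length_cons total_length_cat => len.
set X : R := (\sum_(p <- L2) `|F p.2 - F p.1|).
set Y : \bar R := (\sum_(p <- L1) total_variation p.1 p.2 F)%E.
have ord1 : all (fun p : R * R => p.1 <= p.2) L1 by move: ord; rewrite all_cat => /andP[].
have Y0 : (0 <= Y)%E.
  rewrite /Y big_seq; apply: sume_ge0 => r /(allP ord1) ?; exact: total_variation_ge0.
have Yfin : Y \is a fin_num.
  have := ih [::]; rewrite cats0 big_nil adde0 -/Y => /(_ _ _)/wrap[].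
    move: ord dis; rewrite /nonoverlapping all_cat pairwise_cat => /andP[-> _].
    by move=> /and3P[_ ->].
  have : 0 <= total_length L2.
    rewrite /total_length big_seq; apply: sumr_ge0 => r rL; rewrite subr_ge0.
    by apply: (allP ord); rewrite mem_cat rL orbT.
  by lra.
  by move=> Ye; rewrite ge0_fin_numE// (le_lt_trans Ye) ?ltry.
rewrite big_cons -/Y -addeA -leeBrDr ?fin_numD ?Yfin//.
apply: ge_ereal_sup => _ [_ [s ps <-] <-].
have [/andP[nos1 nos2] subs lens ->] := itv_partition_pairs F ps.
rewrite leeBrDr ?fin_numD ?Yfin// addeCA -EFinD -big_cat /=; apply: ih.
- move: ord dis; rewrite /nonoverlapping !all_cat !pairwise_cat => /andP[-> ->].
  move=> /and3P[d12 -> ->]; rewrite nos1 nos2 /= !andbT allrel_catr d12 andbT /=.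
  move: disp; rewrite all_cat => /andP[d1 d2]; apply/andP; split.
    apply/allrelP => r t /(allP d1) + /(allP subs) /andP[].
    by move=> /orP[] ? ? ?; apply/orP; [right|left]; lra.
  apply/allrelP => r t /(allP subs) /andP[] ? ? /(allP d2).
  by move=> /orP[] ?; apply/orP; [left|right]; lra.
- by rewrite !total_length_cat lens; lra.
Qed.

Lemma uniformly_ac_bounded_variation F c d : uniformly_ac F -> c <= d ->
  total_variation c d F \is a fin_num.
Proof.
move=> acF cd; have [del del0 H] := uniformly_ac_total_variation_le acF ltr01.
pose h := del / 2; have h0 : 0 < h by rewrite divr_gt0.
have step t : (total_variation t (t + h) F <= 1)%E.
  have := H [:: (t, t + h)]; rewrite big_seq1 /=; apply.
    by rewrite /nonoverlapping /= !andbT lerDl ltW.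
  by rewrite /total_length big_seq1 /= addrAC subrr add0r /h ltr_pdivrMr// ltr_pMr// ltr1n.
have steps n : (total_variation c (c + h *+ n) F <= n%:R%:E)%E.
  elim: n => [|n ih]; first by rewrite mulr0n addr0 total_variationxx.
  have hn : 0 <= h *+ n by rewrite mulrn_wge0// ltW.
  rewrite (@total_variationD _ c _ (c + h *+ n)) ?lerDl//; last first.
    by rewrite lerD2l mulrS lerDr ltW.
  by rewrite mulrSr addrA -natr1 EFinD; exact: leeD.
have [n nd] : exists n, d <= c + h *+ n.
  exists (Num.truncn ((d - c) / h)).+1.
  rewrite -lerBlDl -mulr_natr -ler_pdivrMl// mulrC.
  by apply/ltW; rewrite truncnS_gt.
rewrite ge0_fin_numE ?total_variation_ge0//.
apply: (@le_lt_trans _ _ n%:R%:E); last by rewrite ltry.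
apply: le_trans (steps n); rewrite (total_variationD F cd nd) leeDl//.
exact: total_variation_ge0.
Qed.

Lemma uniformly_acB F G : uniformly_ac F -> uniformly_ac G -> uniformly_ac (F \- G).
Proof.
move=> acF acG e e0; have e20 : 0 < e / 2 by rewrite divr_gt0.
have [d1 d10 H1] := acF _ e20; have [d2 d20 H2] := acG _ e20.
exists (Num.min d1 d2); first by rewrite lt_min d10 d20.
move=> L noL; rewrite lt_min => /andP[l1 l2].
rewrite [ltRHS]splitr; apply: le_lt_trans (ltrD (H1 _ noL l1) (H2 _ noL l2)).
rewrite -big_split /=; apply: ler_sum => p _.
rewrite [X in `|X|](_ : _ = (F p.2 - F p.1) - (G p.2 - G p.1)) /=; last by ring.
exact: ler_normB.
Qed.

Lemma uniformly_ac_continuous F : uniformly_ac F -> continuous F.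
Proof.
move=> acF t; apply/cvgrPdist_lt => e e0.
have [del del0 H] := acF e e0.
near=> s.
have st : `|t - s| < del by near: s; exact: cvgr_dist_lt.
have [le|/ltW le] := leP s t.
- have := H [:: (s, t)]; rewrite big_seq1; apply.
    by rewrite /nonoverlapping /= le.
  by rewrite /total_length big_seq1 (le_lt_trans (ler_norm _)).
- rewrite distrC; have := H [:: (t, s)]; rewrite big_seq1; apply.
    by rewrite /nonoverlapping /= le.
  by rewrite /total_length big_seq1 (le_lt_trans (ler_norm _))// distrC.
Unshelve. all: by end_near. Qed.

Lemma absolutely_continuous_monotone_decomposition c d F : c <= d ->
  absolutely_continuous_on c d F ->
  exists M1 M2 : R -> R,
    [/\ nondecreasing M1, nondecreasing M2, uniformly_ac M1, uniformly_ac M2 &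
     [/\ forall t, M1 (clamp c d t) = M1 t, forall t, M2 (clamp c d t) = M2 t &
      forall t, c <= t <= d -> F t = M1 t - M2 t]].
Proof.
move=> cd /(uniformly_ac_clamp cd); set G := F \o clamp c d => acG.
have clampK t : clamp c d (clamp c d t) = clamp c d t.
  exact/clamp_id/clamp_in.
pose T t := fine (total_variation c (clamp c d t) G).
have TB s t : s <= t ->
    (T t - T s)%:E = total_variation (clamp c d s) (clamp c d t) G.
  move=> st; have /andP[cs sd] := clamp_in s cd.
  have /andP[ct td] := clamp_in t cd.
  rewrite EFinB /T !fineK ?uniformly_ac_bounded_variation//.
  rewrite (total_variationD G cs (clamp_le c d st)) addeAC subee ?add0e//.
  exact: uniformly_ac_bounded_variation.
have GT s t : s <= t -> `|G t - G s| <= T t - T s.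
  move=> st; rewrite -lee_fin TB//.
  have := total_variation_ge G (clamp_le c d st).
  by rewrite /G /= !clampK.
have acT : uniformly_ac T.
  move=> e e0; have e20 : 0 < e / 2 by rewrite divr_gt0.
  have [del del0 H] := uniformly_ac_total_variation_le acG e20.
  exists del => // L /andP[ord dis] len.
  pose L' := [seq (clamp c d p.1, clamp c d p.2) | p <- L].
  have noL' : nonoverlapping L'.
    rewrite /nonoverlapping /L' all_map pairwise_map; apply/andP; split.
      by apply: sub_all ord => p /=; exact: clamp_le.
    by apply: sub_pairwise dis => p q /= /orP[] /(clamp_le c d) ->; rewrite ?orbT.
  have len' : total_length L' < del.
    apply: le_lt_trans len; rewrite /total_length big_map big_seq [leRHS]big_seq.
    by apply: ler_sum => p pL /=; apply/clamp_lipschitz/(allP ord).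
  have := H L' noL' len'; rewrite big_map /= => le.
  rewrite -lte_fin (@le_lt_trans _ _ (e / 2)%:E)//; last first.
    by rewrite lte_fin ltr_pdivrMr// ltr_pMr// ltr1n.
  apply: le_trans le; rewrite -sumEFin big_seq [leRHS]big_seq.
  apply: lee_sum => p /(allP ord) op; rewrite -TB// ger0_norm//.
  exact: le_trans (GT _ _ op).
exists T, (T \- G); split => //.
- by move=> s t st; rewrite -subr_ge0 (le_trans _ (GT _ _ st)).
- move=> s t st; rewrite -subr_ge0 /=.
  by have := GT _ _ st => /(le_trans (ler_norm _)); lra.
- exact: uniformly_acB.
- by split=> [t|t|t ctd]; rewrite /T /G /= ?clampK// clamp_id//; ring.
Qed.

Local Notation leb := (@lebesgue_measure R).

(** The components of an open set of finite measure are bounded open intervals. *)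
Lemma open_interval_finite_measure (J : set R) : open J -> is_interval J ->
  J !=set0 -> (leb J < +oo)%E -> exists p : R * R, p.1 < p.2 /\ J = `]p.1, p.2[%classic.
Proof.
move=> oJ /is_intervalP; set i := Rhull J => EJ [x Jx] finJ.
have xi : x \in i by rewrite EJ in Jx.
have oi t : t \in i -> exists2 e, 0 < e & forall s, `|t - s| < e -> s \in i.
  move=> ti; have Jt : J t by rewrite EJ.
  have /nbhs_ballP[e /= e0 He] := open_nbhs_nbhs (conj oJ Jt).
  by exists e => // s /He; rewrite EJ.
have left t : t \in i -> exists2 s, s < t & s \in i.
  move=> /oi[e e0 He]; exists (t - e / 2); first by lra.
  by apply: He; rewrite opprB addrC subrK ger0_norm; lra.
have right t : t \in i -> exists2 s, t < s & s \in i.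
  move=> /oi[e e0 He]; exists (t + e / 2); first by lra.
  by apply: He; rewrite opprD addNKr normrN ger0_norm; lra.
move: finJ; rewrite EJ lebesgue_measure_itv.
move: i xi left right {EJ oi Jx} => -[[bl l|[]] [br r|[]]] //= xi left right.
- move=> _; exists (l, r) => /=.
  case: bl xi left right => xi left right.
    have : l \in Interval (BLeft l) (BSide br r).
      by move: xi; rewrite !in_itv /= lexx => /andP[lx]; case: (br) => /=;
        [exact: le_lt_trans | exact: le_trans].
    by move=> /left[s sl]; rewrite in_itv /= leNgt sl.
  case: br xi left right => xi left right; last first.
    have : r \in Interval (BRight l) (BRight r).
      by move: xi; rewrite !in_itv /= lexx andbT => /andP[]; exact: lt_le_trans.
    by move=> /right[s rs]; rewrite in_itv /= andbC leNgt rs.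
  by move: xi; rewrite in_itv /= => /andP[lx xr]; split => //; exact: lt_trans xr.
- by move: xi; rewrite in_itv /= andbF.
- by rewrite ltry ltxx.
- by rewrite ltNyr ltxx.
Qed.

Lemma stieltjes_measure_itv (M : cumulative R R) s t : s <= t ->
  lebesgue_stieltjes_measure M `]s, t]%classic = (M t - M s)%:E.
Proof.
move=> st; rewrite /lebesgue_stieltjes_measure /measure_extension measurable_mu_extE/=.
  by rewrite wlength_itv_bnd.
exact: is_ocitv.
Qed.

(** A Lebesgue-null set is covered by an open set of small measure; absolute
    continuity bounds the Stieltjes measure of the union of finitely many of its
    components. *)
Lemma stieltjes_measure_dominated (M : cumulative R R) :
  uniformly_ac M -> lebesgue_stieltjes_measure M `<< leb.
Proof.
move=> acM; apply/null_content_dominatesP => A mA A0.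
set mu := lebesgue_stieltjes_measure M.
apply/eqP; rewrite eq_le measure_ge0 andbT; apply/lee_addgt0Pr => e e0.
rewrite add0e; have [del del0 H] := acM e e0.
have [U [oU AU UA]] : exists U : set R, [/\ open U, A `<=` U & (leb (U `\` A) < del%:E)%E].
  by apply: lebesgue_regularity_outer => //; rewrite A0.
have mU : measurable U by exact: open_measurable.
have Udel : (leb U < del%:E)%E.
  rewrite (_ : leb U = leb (U `\` A))//.
  rewrite -[in LHS](setDUK AU) measureU ?A0 ?add0e//; first exact: measurableD.
  by apply/seteqP; split => t /=; tauto.
(* The components of U; the empty ones are discarded below, as the list of
   intervals must consist of genuine ones. *)
pose J := open_disjoint_itv oU.
have mJ k : measurable (J k) by apply: open_measurable; exact: open_disjoint_itv_open.
have JU k : J k `<=` U.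
  by move=> t Jt; rewrite (open_disjoint_itv_bigcup oU); exists k.
have finJ k : (leb (J k) < +oo)%E.
  rewrite (@le_lt_trans _ _ (leb U))//; last by rewrite (lt_trans Udel) ?ltry.
  by apply: le_measure; [by apply: mem_set; exact: mJ|by apply: mem_set|exact: JU].
have /choice[p Hp] : forall k, exists p : R * R, J k !=set0 ->
    p.1 < p.2 /\ J k = `]p.1, p.2[%classic.
  move=> k; have [J0|J0] := pselect (J k !=set0); last by exists (0, 0).
  have [p ?] := open_interval_finite_measure (@open_disjoint_itv_open _ _ oU k)
    (@open_disjoint_itv_is_interval _ _ oU k) J0 (finJ k).
  by exists p.
apply: (@le_trans _ _ (\sum_(0 <= k <oo) mu (J k))%E).
  apply: measure_sigma_subadditive => //.
  by rewrite -open_disjoint_itv_bigcup.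
apply: lime_le; first by apply: is_cvg_nneseries => n _ _; exact: measure_ge0.
apply: nearW => n.
pose s := [seq k <- iota 0 n | `[<J k !=set0>]].
have Js k : k \in s -> J k !=set0 by rewrite mem_filter => /andP[/asboolP].
have -> : (\sum_(0 <= k < n) mu (J k) = \sum_(k <- s) mu (J k))%E.
  rewrite /s big_filter [RHS]big_mkcond /= /index_iota subn0.
  apply: eq_bigr => k _; case: asboolP => // /set0P/negP/negPn/eqP ->.
  by rewrite /mu measure0.
have muJ k : k \in s -> (mu (J k) <= (`|M (p k).2 - M (p k).1|)%:E)%E.
  move=> /Js /Hp[pk Jk].
  rewrite ger0_norm ?subr_ge0; last by apply: (cumulative_is_nondecreasing M); exact: ltW.
  rewrite -stieltjes_measure_itv; last exact: ltW.
  apply: le_measure; [by apply: mem_set; exact: mJ|apply: mem_set; exact: (measurable_itv `](p k).1, (p k).2])|].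
  rewrite Jk; exact: subset_itv_oo_oc.
apply: (@le_trans _ _ (\sum_(k <- s) `|M (p k).2 - M (p k).1|)%:E).
  by rewrite -sumEFin big_seq [leRHS]big_seq; apply: lee_sum => k; exact: muJ.
rewrite lee_fin ltW//.
have := H [seq p k | k <- s]; rewrite big_map; apply.
- rewrite /nonoverlapping all_map pairwise_map; apply/andP; split.
    by apply/allP => k /Js /Hp[/ltW].
  apply/(pairwiseP 0%N) => k l; rewrite !inE => ks ls kl.
  have ne : nth 0%N s k != nth 0%N s l.
    by rewrite nth_uniq ?filter_uniq ?iota_uniq// ltn_eqF.
  have [pk Jk] := Hp _ (Js _ (mem_nth 0%N ks)).
  have [pl Jl] := Hp _ (Js _ (mem_nth 0%N ls)).
  have /trivIsetP /(_ _ _ I I ne) := @open_disjoint_itv_trivIset _ _ oU.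
  rewrite -/J Jk Jl => JJ; move: pk pl JJ => /=.
  set u := p (nth 0%N s k); set v := p (nth 0%N s l) => pk pl JJ.
  have [//|vu] := leP u.2 v.1; have [_|uv] := leP v.2 u.1; first by rewrite ?orbT.
  suff : set0 ((Num.max u.1 v.1 + Num.min u.2 v.2) / 2) by [].
  rewrite -JJ; split; rewrite /= in_itv /= maxEle minEle;
    by case: ifP; case: ifP; lra.
- rewrite /total_length big_map -lte_fin (le_lt_trans _ Udel)//.
  rewrite -sumEFin (@le_trans _ _ (\sum_(k <- s) leb (J k))%E)//.
    rewrite big_seq [leRHS]big_seq; apply: lee_sum => k /Js /Hp[pk ->].
    by rewrite lebesgue_measure_itv /= lte_fin pk EFinB.
  apply: (@le_trans _ _ (\sum_(0 <= k < n) leb (J k))%E).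
    rewrite /s big_filter [leLHS]big_mkcond /= /index_iota subn0.
    by apply: lee_sum => k _; case: ifP => // _; exact: measure_ge0.
  rewrite [in leRHS](open_disjoint_itv_bigcup oU) measure_semi_bigcup//.
  - by apply: nneseries_lim_ge => k _ _; exact: measure_ge0.
  - exact: open_disjoint_itv_trivIset.
  - by rewrite -open_disjoint_itv_bigcup.
Qed.

Lemma ae_leb_filter : Filter (almost_everywhere leb).
Proof. exact: ae_filter_ringOfSetsType. Qed.
#[global] Existing Instance ae_leb_filter.

(** The density is the Radon-Nikodym derivative of the Stieltjes measure of M,
    restricted to ]c, d] to make it finite. *)
Lemma uniformly_ac_nondecreasing_density (M : R -> R) c d : c <= d ->
  nondecreasing M -> uniformly_ac M ->
  exists2 g : R -> R, leb.-integrable setT (EFin \o g) &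
    forall t, c <= t <= d -> M t - M c = \int[leb]_(x in `]c, t]) g x.
Proof.
move=> cd ndM acM.
pose Mc : cumulative R R := HB.pack M (@isCumulative.Build R _ R M ndM
  (right_continuousW (uniformly_ac_continuous acM))).
have mD : (measurable (`]c, d]%classic : set (measurableTypeR R))).
  exact: (measurable_itv `]c, d]).
have finD : (lebesgue_stieltjes_measure Mc `]c, d]%classic < +oo)%E.
  by rewrite stieltjes_measure_itv// ltry.
pose nu : {finite_measure set (measurableTypeR R) -> \bar R} := mfrestr mD finD.
have dom : nu `<< leb.
  apply/null_content_dominatesP => A mA A0.
  have /null_content_dominatesP := stieltjes_measure_dominated (M := Mc) acM.
  move=> /(_ A mA A0) MA0; apply/eqP; rewrite eq_le measure_ge0 andbT -MA0.
  exact: measureIl.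
have [f [f0 ffin intf fE]] := radon_nikodym_sigma_finite dom.
exists (fine \o f).
  by rewrite (_ : EFin \o _ = f)//; apply/funext => x /=; rewrite fineK.
move=> t /andP[ct td]; rewrite /Rintegral.
rewrite (_ : (fun x => ((fine \o f) x)%:E) = f); last first.
  by apply/funext => x /=; rewrite fineK.
rewrite -fE; last exact: (measurable_itv `]c, t]).
have -> : nu `]c, t]%classic = lebesgue_stieltjes_measure Mc `]c, t]%classic.
  rewrite /nu /= /mfrestr /mrestr (_ : `]c, t] `&` `]c, d] = `]c, t])%classic//.
  apply/setIidl; exact: subset_itvl.
by rewrite stieltjes_measure_itv.
Qed.

(** The fundamental theorem of calculus for absolutely continuous functions. *)
Theorem absolutely_continuous_FTC c d F : c <= d ->
  absolutely_continuous_on c d F ->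
  exists g : R -> R, [/\ leb.-integrable setT (EFin \o g),
    (forall t, c <= t <= d -> F t - F c = \int[leb]_(x in `]c, t]) g x) &
    {ae leb, forall t, c < t < d -> derivable F t 1 /\ derive1 F t = g t}].
Proof.
move=> cd /(absolutely_continuous_monotone_decomposition cd).
move=> [M1 [M2 [nd1 nd2 ac1 ac2 [_ _ FM]]]].
have [g1 int1 M1g] := uniformly_ac_nondecreasing_density cd nd1 ac1.
have [g2 int2 M2g] := uniformly_ac_nondecreasing_density cd nd2 ac2.
pose g x := g1 x - g2 x.
have intg : leb.-integrable setT (EFin \o g).
  rewrite (_ : EFin \o g = (EFin \o g1) \- (EFin \o g2))%E; last first.
    by apply/funext => x.
  exact: integrableB.
have intS (h : R -> R) (i : interval R) : leb.-integrable setT (EFin \o h) ->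
    leb.-integrable [set` i] (EFin \o h).
  by apply: integrableS => //; exact: measurable_itv.
have FE t : c <= t <= d -> F t - F c = \int[leb]_(x in `]c, t]) g x.
  move=> ctd; rewrite !FM ?lexx ?cd// RintegralB; [|exact: measurable_itv|exact: intS|exact: intS].
  by rewrite -M1g// -M2g//; ring.
exists g; split => //.
have locg : locally_integrable [set: R] g by apply: open_integrable_locally => //; exact: openT.
have := @FTC1 _ g (BRight c) (fun y => intS _ _ intg) locg.
apply: filterS => t /= H /andP[ct td].
have [der eq] := H ct.
have near_eq : {near t, (fun y => F c + \int[leb]_(x in `]c, y]) g x) =1 F}.
  near=> y; rewrite -FE; first by ring.
  by apply/andP; split; apply: ltW; near: y; [exact: lt_nbhsr|exact: lt_nbhsl].
split.
  by apply: near_eq_derivable near_eq _; apply: derivableD => //; exact: derivable_cst.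
rewrite derive1E -(@near_eq_derive _ _ _ _ _ _ (1 : R^o) near_eq) deriveD//.
by rewrite derive_cst add0r -derive1E.
Unshelve. all: by end_near. Qed.

Corollary absolutely_continuous_ae_derivable c d F : c <= d ->
  absolutely_continuous_on c d F ->
  {ae leb, forall t, c < t < d -> derivable F t 1}.
Proof.
move=> cd /(absolutely_continuous_FTC cd)[g [_ _]].
by apply: filterS => t H /H[].
Qed.

(** As F is differentiable almost everywhere, the hypothesis on derive1 concerns
    the genuine derivative. *)
Corollary absolutely_continuous_derivative_le0 c d F : c <= d ->
  absolutely_continuous_on c d F ->
  {ae leb, forall t, c < t < d -> derive1 F t <= 0} -> F d <= F c.
Proof.
move=> cd /(absolutely_continuous_FTC cd)[g [intg FE Fg]] F0.
rewrite -subr_le0 FE ?lexx ?cd//.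
have inti : leb.-integrable `]c, d[ (EFin \o g).
  by apply: integrableS intg => //; exact: measurable_itv.
rewrite -Rintegral_itv_bndo_bndc//.
rewrite /Rintegral fine_le0//.
have -> : (\int[leb]_(x in `]c, d[) (g x)%:E =
    \int[leb]_(x in `]c, d[) (Num.min (g x) 0)%:E)%E.
  apply: ae_eq_integral; first exact: measurable_itv.
  - by have /integrableP[] := inti.
  - apply/measurable_EFinP; apply: measurable_minr => //.
    by have /integrableP[/measurable_EFinP] := inti.
  - move: Fg; apply: filterS2 F0 => t F0 Fg; rewrite /= in_itv /= => ctd.
    have [_ <-] := Fg ctd; congr EFin; rewrite (min_idPl _)//; exact: F0.
have -> : (\int[leb]_(x in `]c, d[) (Num.min (g x) 0)%:E =
    \int[leb]_(x in `]c, d[) (- (- Num.min (g x) 0)%:E))%E.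
  by apply: eq_integral => x _; rewrite EFinN oppeK.
rewrite integral_ge0N ?oppe_le0 => [|x _].
  by apply: integral_ge0 => x _; rewrite lee_fin oppr_ge0 ge_min lexx orbT.
by rewrite lee_fin oppr_ge0 ge_min lexx orbT.
Qed.

Corollary absolutely_continuous_derivative_eq0 c d F : c <= d ->
  absolutely_continuous_on c d F ->
  {ae leb, forall t, c < t < d -> derive1 F t = 0} -> F d = F c.
Proof.
move=> cd /(absolutely_continuous_FTC cd)[g [intg FE Fg]] F0.
apply/eqP; rewrite -subr_eq0 FE ?lexx ?cd//; apply/eqP.
have inti : leb.-integrable `]c, d[ (EFin \o g).
  by apply: integrableS intg => //; exact: measurable_itv.
rewrite -Rintegral_itv_bndo_bndc// /Rintegral.
have -> : (\int[leb]_(x in `]c, d[) (g x)%:E = \int[leb]_(x in `]c, d[) 0%E)%E.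
  apply: ae_eq_integral; first exact: measurable_itv.
  - by have /integrableP[] := inti.
  - exact: measurable_cst.
  - move: Fg; apply: filterS2 F0 => t F0 Fg; rewrite /= in_itv /= => ctd.
    by have [_ <-] := Fg ctd; rewrite F0.
by rewrite integral0.
Qed.

End AbsoluteContinuity.

(** * Operations on absolutely continuous functions and Gronwall's inequality *)

Section Gronwall.
Context (R : realType).
Implicit Types (c d t : R) (f g h N : R -> R).
Local Notation leb := (@lebesgue_measure R).

(** A function whose increments are controlled by those of two absolutely
    continuous functions is absolutely continuous. *)
Lemma absolutely_continuous_control c d f g h K :
  absolutely_continuous_on c d f -> absolutely_continuous_on c d g ->
  (forall u v, c <= u -> u <= v -> v <= d ->
     `|h v - h u| <= K * (`|f v - f u| + `|g v - g u|)) ->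
  absolutely_continuous_on c d h.
Proof.
move=> acf acg hK e e0; pose C := `|K| + 1.
have C0 : 0 < C by rewrite /C ltr_wpDl.
have e20 : 0 < e / (2 * C) by rewrite divr_gt0// mulr_gt0.
have [d1 d10 H1] := acf _ e20; have [d2 d20 H2] := acg _ e20.
exists (Num.min d1 d2); first by rewrite lt_min d10 d20.
move=> n u v uv dis; rewrite lt_min => /andP[l1 l2].
have := ltrD (H1 n u v uv dis l1) (H2 n u v uv dis l2).
rewrite -big_split /= => H.
have eC : e = C * (e / (2 * C) + e / (2 * C)) by field; rewrite gt_eqF.
rewrite [ltRHS]eC; apply: le_lt_trans (_ : C * _ < _); last by rewrite ltr_pM2l//; exact: H.
rewrite mulr_sumr; apply: ler_sum => i _; have [cu uvi vd] := uv i.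
apply: le_trans (hK _ _ cu uvi vd) _; rewrite ler_wpM2r ?addr_ge0//.
by rewrite (le_trans (ler_norm K))// lerDl.
Qed.

Lemma absolutely_continuous_bounded c d f : c <= d -> absolutely_continuous_on c d f ->
  exists2 K, 0 <= K & forall t, c <= t <= d -> `|f t| <= K.
Proof.
move=> cd /(absolutely_continuous_monotone_decomposition cd).
move=> [M1 [M2 [nd1 nd2 _ _ [_ _ fM]]]].
exists (`|M1 c| + `|M1 d| + `|M2 c| + `|M2 d|); first by rewrite !addr_ge0.
move=> t /[dup] /fM -> /andP[ct td].
have := nd1 _ _ ct; have := nd1 _ _ td; have := nd2 _ _ ct; have := nd2 _ _ td.
have := ler_norm (M1 c); have := ler_norm (M1 d); have := ler_norm (M2 c); have := ler_norm (M2 d).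
have := ler_norm (- M1 c); have := ler_norm (- M1 d); have := ler_norm (- M2 c); have := ler_norm (- M2 d).
by rewrite !normrN ler_norml => *; apply/andP; split; lra.
Qed.

Lemma absolutely_continuousB c d f g : absolutely_continuous_on c d f ->
  absolutely_continuous_on c d g -> absolutely_continuous_on c d (fun t => f t - g t).
Proof.
move=> acf acg; apply: (absolutely_continuous_control (K := 1) acf acg) => u v _ _ _.
rewrite mul1r (_ : _ - _ = (f v - f u) - (g v - g u)); last by ring.
exact: ler_normB.
Qed.

Lemma absolutely_continuousD c d f g : absolutely_continuous_on c d f ->
  absolutely_continuous_on c d g -> absolutely_continuous_on c d (fun t => f t + g t).
Proof.
move=> acf acg; apply: (absolutely_continuous_control (K := 1) acf acg) => u v _ _ _.
rewrite mul1r (_ : _ - _ = (f v - f u) + (g v - g u)); last by ring.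
exact: ler_normD.
Qed.

Lemma absolutely_continuousM c d f g : c <= d -> absolutely_continuous_on c d f ->
  absolutely_continuous_on c d g -> absolutely_continuous_on c d (fun t => f t * g t).
Proof.
move=> cd acf acg.
have [Kf Kf0 fK] := absolutely_continuous_bounded cd acf.
have [Kg Kg0 gK] := absolutely_continuous_bounded cd acg.
apply: (absolutely_continuous_control (K := Kf + Kg) acf acg) => u v cu uv vd.
rewrite (_ : _ - _ = (f v - f u) * g v + f u * (g v - g u)); last by ring.
apply: le_trans (ler_normD _ _) _; rewrite !normrM mulrDl !mulrDr.
have gv : `|g v| <= Kg by apply: gK; rewrite vd (le_trans cu).
have fu : `|f u| <= Kf by apply: fK; rewrite cu (le_trans uv).
have := ler_wpM2l (normr_ge0 (f v - f u)) gv.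
have := ler_wpM2r (normr_ge0 (g v - g u)) fu.
have : 0 <= Kf * `|f v - f u| by rewrite mulr_ge0.
have : 0 <= Kg * `|g v - g u| by rewrite mulr_ge0.
by rewrite (mulrC _ Kg); lra.
Qed.

Lemma expR_lipschitz (K x y : R) : x <= K -> y <= K ->
  `|expR x - expR y| <= expR K * `|x - y|.
Proof.
wlog xy : x y / y <= x.
  move=> H xK yK; have [yx|/ltW xy] := leP y x; first exact: H.
  by rewrite distrC (distrC x); exact: H.
move=> xK yK; rewrite !ger0_norm ?subr_ge0 ?ler_expR//.
have : expR x * (1 + (y - x)) <= expR y.
  have -> : expR y = expR x * expR (y - x) by rewrite -expRD; congr expR; ring.
  by rewrite ler_wpM2l ?expR_ge0// expR_ge1Dx.
have : expR x * (x - y) <= expR K * (x - y).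
  by rewrite ler_wpM2r ?subr_ge0// ler_expR.
by lra.
Qed.

Lemma absolutely_continuous_expR c d f : c <= d -> absolutely_continuous_on c d f ->
  absolutely_continuous_on c d (fun t => expR (f t)).
Proof.
move=> cd acf; have [K K0 fK] := absolutely_continuous_bounded cd acf.
apply: (absolutely_continuous_control (K := expR K) acf acf) => u v cu uv vd.
have fv : f v <= K by apply: le_trans (ler_norm _) (fK _ _); rewrite vd (le_trans cu).
have fu : f u <= K by apply: le_trans (ler_norm _) (fK _ _); rewrite cu (le_trans uv).
apply: le_trans (expR_lipschitz fv fu) _.
by rewrite ler_wpM2l ?expR_ge0// lerDl.
Qed.

Lemma absolutely_continuous_integral (k : R -> R) c0 c d :
  leb.-integrable setT (EFin \o k) -> (forall t, 0 <= k t) -> c0 <= c ->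
  absolutely_continuous_on c d (fun t => \int[leb]_(x in `]c0, t]) k x).
Proof.
move=> intk k0 c0c e e0.
have [del [del0 H]] := integral_normr_continuous intk e0.
exists del => // n u v uv dis len.
have intS (i : interval R) : leb.-integrable [set` i] (EFin \o k).
  by apply: integrableS intk => //; exact: measurable_itv.
have -> : \sum_(i < n) `|\int[leb]_(x in `]c0, v i]) k x - \int[leb]_(x in `]c0, u i]) k x|
  = \sum_(i < n) \int[leb]_(x in `]u i, v i[) k x.
  apply: eq_bigr => i _; have [cu uvi vd] := uv i.
  rewrite Rintegral_itvB; [|exact: intS|by rewrite /= bnd_simp (le_trans c0c)|by rewrite /= bnd_simp].
  by rewrite ger0_norm ?Rintegral_itv_bndo_bndc ?Rintegral_ge0.
pose D := \big[setU/set0]_(i < n) `]u i, v i[%classic.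
have mD : measurable (D : set (measurableTypeR R)).
  by apply: bigsetU_measurable => i _; exact: (measurable_itv `]u i, v i[).
have mk A : measurable_fun (A : set (measurableTypeR R)) (EFin \o k).
  by apply: measurable_funTS; have /integrableP[] := intk.
have tI : trivIset [set` index_enum 'I_n] (fun i : 'I_n => `]u i, v i[%classic).
  by apply: sub_trivIset dis.
have -> : \sum_(i < n) \int[leb]_(x in `]u i, v i[) k x = \int[leb]_(x in D) `|k x|.
  under [RHS]eq_Rintegral do rewrite ger0_norm//.
  apply: EFin_inj; rewrite -sumEFin /Rintegral fineK; last first.
    by apply: integrable_fin_num => //; exact: integrableS intk.
  have mi i : measurable (`]u i, v i[%classic : set (measurableTypeR R)).
    exact: (measurable_itv `]u i, v i[).
  rewrite (integral_bigsetU_EFin leb mi (index_enum_uniq _) tI (mk D)).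
  by apply: eq_bigr => i _; rewrite fineK//; apply: integrable_fin_num.
apply: H => //; apply: (@le_lt_trans _ _ (\sum_(i < n) (v i - u i))%:E); last by rewrite lte_fin.
rewrite -sumEFin /D measure_bigsetU_ord//.
apply: lee_sum => i _; have [_ uvi _] := uv i.
rewrite [leLHS](lebesgue_measure_itv `]u i, v i[) /= lte_fin.
by case: ltP => // _; rewrite lee_fin subr_ge0.
Qed.

Lemma ae_derivable_integral (k : R -> R) c0 : leb.-integrable setT (EFin \o k) ->
  {ae leb, forall t, c0 < t ->
    is_derive t 1 (fun t => \int[leb]_(x in `]c0, t]) k x) (k t)}.
Proof.
move=> intk; have intS (i : interval R) : leb.-integrable [set` i] (EFin \o k).
  by apply: integrableS intk => //; exact: measurable_itv.
have lock : locally_integrable [set: R] k by apply: open_integrable_locally => //; exact: openT.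
have := @FTC1 _ k (BRight c0) (fun y => intS _) lock.
apply: filterS => t /= H ct; have [der <-] := H ct.
by rewrite derive1E; exact: derivableP.
Qed.

(** If |N'| <= k N almost everywhere, N cannot grow or decay by more than the
    exponential of the integral of k; the constant is uniform over subintervals. *)
Lemma gronwall (k : R -> R) c0 d0 :
  leb.-integrable setT (EFin \o k) -> (forall t, 0 <= k t) -> c0 <= d0 ->
  exists2 C, 0 < C & forall c d N, c0 <= c -> c <= d -> d <= d0 ->
    absolutely_continuous_on c d N -> (forall t, 0 <= N t) ->
    {ae leb, forall t, c < t < d -> `|derive1 N t| <= k t * N t} ->
    N d <= C * N c /\ N c <= C * N d.
Proof.
move=> intk k0 cd0; pose G t := \int[leb]_(x in `]c0, t]) k x.
exists (expR (G d0)); first exact: expR_gt0.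
move=> c d N c0c cd dd0 acN N0 dN.
have intS (i : interval R) : leb.-integrable [set` i] (EFin \o k).
  by apply: integrableS intk => //; exact: measurable_itv.
have Gle s t : c0 <= s -> s <= t -> G s <= G t.
  move=> cs st; rewrite -subr_ge0 /G Rintegral_itvB;
    [|exact: intS|by rewrite /= bnd_simp|by rewrite /= bnd_simp].
  exact: Rintegral_ge0.
have Gc : 0 <= G c by exact: Rintegral_ge0.
have Gd : G d <= G d0 by apply: Gle => //; exact: le_trans cd.
have acG : absolutely_continuous_on c d G by exact: absolutely_continuous_integral.
have acNG : absolutely_continuous_on c d (fun t => - G t).
  apply: (absolutely_continuous_control (K := 1) acG acG) => u v _ _ _.
  by rewrite mul1r -opprD normrN lerDl.
have derG := ae_derivable_integral c0 intk.
have derN := absolutely_continuous_ae_derivable cd acN.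
split.
(* The integrating factor exp (- G) makes N exp (- G) nonincreasing, and exp G
   makes N exp G nondecreasing. *)
- have : N d * expR (- G d) <= N c * expR (- G c).
    apply: (@absolutely_continuous_derivative_le0 _ c d (fun t => N t * expR (- G t))) => //.
      apply: absolutely_continuousM => //; exact: absolutely_continuous_expR.
    move: dN derN derG; apply: filterS3 => t dNt derNt derGt ctd.
    have iN : is_derive t 1 N (derive1 N t).
      by rewrite derive1E; apply: derivableP; exact: derNt.
    have iG : is_derive t 1 G (k t).
      by apply: derGt; case/andP: ctd => ct _; exact: le_lt_trans ct.
    have iE : is_derive t 1 (fun t => expR (- G t)) (expR (- G t) * - k t).
      exact: (@is_derive1_comp _ expR (fun t => - G t)).
    rewrite derive1E (@derive_val _ _ _ _ _ _ _ (is_deriveM iN iE)) /GRing.scale /=.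
    have := le_trans (ler_norm _) (dNt ctd) => le.
    rewrite (_ : _ + _ = expR (- G t) * (derive1 N t - k t * N t)); last by ring.
    by rewrite mulr_ge0_le0 ?expR_ge0// subr_le0.
  move=> H; have -> : N d = N d * expR (- G d) * expR (G d).
    by rewrite -mulrA -expRD addNr expR0 mulr1.
  apply: le_trans (ler_wpM2r (expR_ge0 _) H) _.
  rewrite -mulrA -expRD mulrC ler_wpM2r// ler_expR.
  by rewrite (le_trans _ Gd)// gerDr oppr_le0.
- have : - (N d * expR (G d)) <= - (N c * expR (G c)).
    apply: (@absolutely_continuous_derivative_le0 _ c d (fun t => - (N t * expR (G t)))) => //.
      have acNE : absolutely_continuous_on c d (fun t => N t * expR (G t)).
        by apply: absolutely_continuousM => //; exact: absolutely_continuous_expR.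
      apply: (absolutely_continuous_control (K := 1) acNE acNE) => u v _ _ _.
      by rewrite mul1r -opprD normrN lerDl.
    move: dN derN derG; apply: filterS3 => t dNt derNt derGt ctd.
    have iN : is_derive t 1 N (derive1 N t).
      by rewrite derive1E; apply: derivableP; exact: derNt.
    have iG : is_derive t 1 G (k t).
      by apply: derGt; case/andP: ctd => ct _; exact: le_lt_trans ct.
    have iE : is_derive t 1 (fun t => expR (G t)) (expR (G t) * k t).
      exact: (@is_derive1_comp _ expR G).
    rewrite derive1E (@derive_val _ _ _ _ _ _ _ (is_deriveN (is_deriveM iN iE))) /GRing.scale /=.
    have : - (k t * N t) <= derive1 N t.
      by have := dNt ctd; rewrite ler_norml => /andP[].
    rewrite oppr_le0 => le.
    rewrite (_ : _ + _ = expR (G t) * (derive1 N t + k t * N t)); last by ring.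
    by rewrite mulr_ge0 ?expR_ge0// -lerBlDr sub0r.
  rewrite lerN2 => H; have H1 : N c * expR 0 <= N c * expR (G c).
    by rewrite ler_wpM2l// ler_expR.
  rewrite expR0 mulr1 in H1; apply: le_trans H1 _; apply: le_trans H _.
  by rewrite [leRHS]mulrC ler_wpM2l// ler_expR.
Qed.

End Gronwall.

(** * Real solutions: Wronskian and energy *)

Section RealSolutions.
Context (R : realType) (V : R -> R) (E : R).
Implicit Types (U : set R) (c d t : R) (f g h : R -> R).
Local Notation leb := (@lebesgue_measure R).

(** Real solutions on the set U of - f'' + V f = E f, with f and f' locally
    absolutely continuous in U. *)
Definition real_solution U f : Prop :=
  [/\ (forall t, U t -> derivable f t 1),
      (forall c d, c <= d -> `[c, d]%classic `<=` U ->
         absolutely_continuous_on c d f /\ absolutely_continuous_on c d (derive1 f)) &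
      {ae leb, forall t, U t -> derive1 (derive1 f) t = (V t - E) * f t}].

(** The Wronskian f g' - f' g. *)
Definition wronskian f g t : R := f t * derive1 g t - derive1 f t * g t.

(** The squared length of the Cauchy data (f, f'). *)
Definition energy f t : R := f t ^+ 2 + derive1 f t ^+ 2.

Lemma energy_ge0 f t : 0 <= energy f t.
Proof. by rewrite addr_ge0 ?sqr_ge0. Qed.

Lemma ae_second_derivative U f c d : real_solution U f -> c <= d ->
  `[c, d]%classic `<=` U ->
  {ae leb, forall t, c < t < d -> is_derive t 1 f (derive1 f t) /\
     is_derive t 1 (derive1 f) ((V t - E) * f t)}.
Proof.
move=> [df acf eq] cd cdU; have [_ acdf] := acf _ _ cd cdU.
have := absolutely_continuous_ae_derivable cd acdf; move: eq.
apply: filterS2 => t eqt dert ctd.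
have Ut : U t by apply: cdU; rewrite /= in_itv /=; case/andP: ctd => /ltW -> /ltW ->.
split; first by rewrite derive1E; apply: derivableP; exact: df.
by have := derivableP (dert ctd); rewrite -derive1E eqt.
Qed.

(** The Wronskian of two solutions is constant: its almost everywhere derivative
    f g'' - f'' g vanishes. *)
Lemma wronskian_constant U f g c d : real_solution U f -> real_solution U g ->
  c <= d -> `[c, d]%classic `<=` U -> wronskian f g d = wronskian f g c.
Proof.
move=> sf sg cd cdU; have [_ acf _] := sf; have [_ acg _] := sg.
have [ac1 ac2] := acf _ _ cd cdU; have [ac3 ac4] := acg _ _ cd cdU.
apply: absolutely_continuous_derivative_eq0 => //.
  by apply: absolutely_continuousB; exact: absolutely_continuousM.
have := ae_second_derivative sg cd cdU; have := ae_second_derivative sf cd cdU.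
apply: filterS2 => t Hf Hg ctd; have [f1 f2] := Hf ctd; have [g1 g2] := Hg ctd.
rewrite derive1E (@derive_val _ _ _ _ _ _ _ (is_deriveB (is_deriveM f1 g2) (is_deriveM f2 g1))) /GRing.scale /=.
by ring.
Qed.

Lemma energy_derivative_bound (x y v : R) :
  `|x * y + x * y + (y * (v * x) + y * (v * x))| <= (1 + `|v|) * (x ^+ 2 + y ^+ 2).
Proof.
have -> : x * y + x * y + (y * (v * x) + y * (v * x)) = (1 + v) * (2 * (x * y)) by ring.
rewrite normrM; apply: ler_pM => //.
  by apply: le_trans (ler_normD _ _) _; rewrite normr1.
rewrite ler_norml; apply/andP; split.
  by have := sqr_ge0 (x + y); rewrite sqrrD; lra.
by have := sqr_ge0 (x - y); rewrite sqrrB; lra.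
Qed.

(** Uniqueness for the initial value problem, quantitatively: on a compact
    interval of local integrability of V the energies at two points of a
    solution interval are comparable. *)
Lemma energy_comparable (O : set R) c0 d0 : locally_integrable O V -> c0 <= d0 ->
  `[c0, d0]%classic `<=` O ->
  exists2 C, 0 < C & forall U f c d, real_solution U f ->
    c0 <= c -> c <= d -> d <= d0 -> `[c, d]%classic `<=` U ->
    energy f d <= C * energy f c /\ energy f c <= C * energy f d.
Proof.
move=> [mV oO intV] cd0 cdO.
pose I0 : set R := `[c0, d0]%classic.
have mI0 : measurable (I0 : set (measurableTypeR R)) by exact: (measurable_itv `[c0, d0]).
have intI0 : leb.-integrable I0 (EFin \o V).
  apply/integrableP; split; last by apply: intV => //; exact: segment_compact.
  apply/measurable_EFinP; apply: measurable_funS mV => //; exact: open_measurable.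
have fin0 : (leb I0 < +oo)%E.
  by rewrite /I0 lebesgue_measure_itv /=; case: ifP => // _; rewrite -EFinB ltry.
pose k := (fun t => 1 + `|V t - E|) \_ I0.
have k0 t : 0 <= k t by rewrite /k patchE; case: ifP => // _; rewrite addr_ge0.
have intk : leb.-integrable setT (EFin \o k).
  rewrite -restrict_EFin -integrable_mkcond//.
  have i1 (r : R) : leb.-integrable I0 (EFin \o (cst r)).
    apply: (measurable_bounded_integrable mI0 fin0); first by apply: measurable_cst.
    by exists `|r|; split; [exact: num_real | move=> M rM t _ /=; exact: ltW].
  have i2 : leb.-integrable I0 (EFin \o (fun t => V t - E)).
    by have := integrableB mI0 intI0 (i1 E); apply: eq_integrable.
  by have := integrableD mI0 (i1 1) (integrable_norm i2); apply: eq_integrable.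
have [C C0 H] := gronwall intk k0 cd0.
exists C => // U f c d sf c0c cd dd0 cdU; apply: H => //.
- have [_ /(_ _ _ cd cdU)[ac1 ac2] _] := sf.
  by apply: absolutely_continuousD; exact: absolutely_continuousM.
- exact: energy_ge0.
- have := ae_second_derivative sf cd cdU.
  apply: filterS => t Hf ctd; have [f1 f2] := Hf ctd.
  rewrite derive1E (@derive_val _ _ _ _ _ _ _ (is_deriveD (is_deriveM f1 f1) (is_deriveM f2 f2))) /GRing.scale /=.
  have -> : k t = 1 + `|V t - E|.
    rewrite /k patchE ifT// inE /I0 /= in_itv /=.
    by case/andP: ctd => ? ?; apply/andP; split; lra.
  exact: energy_derivative_bound.
Qed.

End RealSolutions.

(** * One-sided limits of solutions *)

Section GluedSolutions.
Context (R : realType) (V : R -> R) (E : R) (O : set R).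
Hypothesis hV : locally_integrable O V.
Implicit Types (U D : set R) (c d p t e : R) (f g h : R -> R).

Lemma near_constant_limit (F : set_system R) (FF : ProperFilter F) f (l k : R) :
  f x @[x --> F] --> l -> (\forall x \near F, f x = k) -> l = k.
Proof.
move=> fl fk; have : f x @[x --> F] --> k.
  by apply: cvg_near_cst; apply: filterS fk => x ->.
by move=> /(cvg_lim (@Rhausdorff R)) <-; apply/esym/cvg_lim.
Qed.

Lemma absolutely_continuous_continuous c d f t : c < t -> t < d ->
  absolutely_continuous_on c d f -> {for t, continuous f}.
Proof.
move=> ct td acf; have cd : c <= d by apply/ltW/(lt_trans ct).
have := uniformly_ac_continuous (uniformly_ac_clamp cd acf) => /(_ t).
rewrite /prop_for /continuous_at /= clamp_id; last by rewrite !ltW.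
apply: cvg_trans; apply: near_eq_cvg; near=> s; rewrite /= clamp_id//.
by apply/andP; split; apply: ltW; near: s; [exact: lt_nbhsr|exact: lt_nbhsl].
Unshelve. all: by end_near. Qed.

Section OneSided.
Variables (U : set R) (p e : R).
Hypothesis e0 : 0 < e.

Lemma real_solution_continuous f t : real_solution V E U f ->
  (\forall s \near t, U s) -> {for t, continuous f} /\ {for t, continuous (derive1 f)}.
Proof.
move=> [_ acf _] /nbhs_ballP[r /= r0 rU].
have [] := acf (t - r / 2) (t + r / 2).
- by lra.
- move=> s /=; rewrite in_itv /= => /andP[? ?]; apply: rU; rewrite /ball /=.
  by rewrite ltr_norml; apply/andP; split; lra.
by move=> ac1 ac2; split; apply: (absolutely_continuous_continuous _ _ ac1) || apply: (absolutely_continuous_continuous _ _ ac2); lra.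
Qed.

(** The constant value of the Wronskian on a one-sided neighborhood is given by
    the one-sided limits of the Cauchy data. *)
Lemma wronskian_right_limit f g (r dr s ds : R) t :
  (forall t, p < t < p + e -> U t) ->
  real_solution V E U f -> real_solution V E U g ->
  f x @[x --> p^'+] --> r -> derive1 f x @[x --> p^'+] --> dr ->
  g x @[x --> p^'+] --> s -> derive1 g x @[x --> p^'+] --> ds ->
  p < t < p + e -> wronskian f g t = r * ds - dr * s.
Proof.
move=> hU sf sg fr fdr gs gds /andP[pt te].
have W : wronskian f g x @[x --> p^'+] --> r * ds - dr * s.
  by apply: cvgB; apply: cvgM.
apply/esym/(near_constant_limit _ W); near=> u.
have ut : u <= t by near: u; exact: nbhs_right_le.
have pu : p < u by near: u; exact: nbhs_right_gt.
apply/esym; apply: (wronskian_constant sf sg ut) => v /=; rewrite in_itv /= => /andP[? ?].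
by apply: hU; apply/andP; split; lra.
Unshelve. all: by end_near. Qed.

Lemma wronskian_left_limit f g (r dr s ds : R) t :
  (forall t, p - e < t < p -> U t) ->
  real_solution V E U f -> real_solution V E U g ->
  f x @[x --> p^'-] --> r -> derive1 f x @[x --> p^'-] --> dr ->
  g x @[x --> p^'-] --> s -> derive1 g x @[x --> p^'-] --> ds ->
  p - e < t < p -> wronskian f g t = r * ds - dr * s.
Proof.
move=> hU sf sg fr fdr gs gds /andP[pt te].
have W : wronskian f g x @[x --> p^'-] --> r * ds - dr * s.
  by apply: cvgB; apply: cvgM.
apply/esym/(near_constant_limit _ W); near=> u.
have tu : t <= u by near: u; exact: nbhs_left_ge.
have up : u < p by near: u; exact: nbhs_left_lt.
apply: (wronskian_constant sf sg tu) => v /=; rewrite in_itv /= => /andP[? ?].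
by apply: hU; apply/andP; split; lra.
Unshelve. all: by end_near. Qed.

(** At any point of a one-sided neighborhood of p the Cauchy data of a solution
    vanish if and only if their limit at p does. *)
Lemma energy_right_limit f (r dr : R) t :
  `[p, p + e]%classic `<=` O -> (forall t, p < t < p + e -> U t) ->
  real_solution V E U f ->
  f x @[x --> p^'+] --> r -> derive1 f x @[x --> p^'+] --> dr ->
  p < t < p + e -> (energy f t == 0) = (r ^+ 2 + dr ^+ 2 == 0).
Proof.
move=> peO hU sf fr fdr /andP[pt te].
have [|C C0 H] := energy_comparable E hV _ peO; first by rewrite lerDl ltW.
have N : energy f x @[x --> p^'+] --> r ^+ 2 + dr ^+ 2.
  by rewrite !expr2; apply: cvgD; apply: cvgM.
have HH : \forall u \near p^'+, energy f t <= C * energy f u /\ energy f u <= C * energy f t.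
  near=> u.
  have ut : u <= t by near: u; exact: nbhs_right_le.
  have pu : p < u by near: u; exact: nbhs_right_gt.
  apply: (H _ f u t sf); rewrite ?ltW// => v /=; rewrite in_itv /= => /andP[? ?].
  by apply: hU; apply/andP; split; lra.
apply/eqP/eqP => [t0|l0].
  apply: (near_constant_limit _ N); apply: filterS HH => u [_].
  by rewrite t0 mulr0 => le; apply/eqP; rewrite eq_le le energy_ge0.
apply/eqP; rewrite eq_le energy_ge0 andbT.
have CN : (C * energy f x) @[x --> p^'+] --> C * 0.
  by apply: cvgM; [exact: cvg_cst|rewrite -l0].
rewrite -(mulr0 C) -(cvg_lim (@Rhausdorff R) CN).
by apply: limr_ge; [apply/cvg_ex; eexists; exact: CN|apply: filterS HH => u []].
Unshelve. all: by end_near. Qed.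

Lemma energy_left_limit f (r dr : R) t :
  `[p - e, p]%classic `<=` O -> (forall t, p - e < t < p -> U t) ->
  real_solution V E U f ->
  f x @[x --> p^'-] --> r -> derive1 f x @[x --> p^'-] --> dr ->
  p - e < t < p -> (energy f t == 0) = (r ^+ 2 + dr ^+ 2 == 0).
Proof.
move=> peO hU sf fr fdr /andP[pt te].
have [|C C0 H] := energy_comparable E hV _ peO; first by rewrite gerBl ltW.
have N : energy f x @[x --> p^'-] --> r ^+ 2 + dr ^+ 2.
  by rewrite !expr2; apply: cvgD; apply: cvgM.
have HH : \forall u \near p^'-, energy f t <= C * energy f u /\ energy f u <= C * energy f t.
  near=> u.
  have tu : t <= u by near: u; exact: nbhs_left_ge.
  have up : u < p by near: u; exact: nbhs_left_lt.
  have [] // := H _ f t u sf; rewrite ?ltW// => v /=; rewrite in_itv /= => /andP[? ?].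
  by apply: hU; apply/andP; split; lra.
apply/eqP/eqP => [t0|l0].
  apply: (near_constant_limit _ N); apply: filterS HH => u [_].
  by rewrite t0 mulr0 => le; apply/eqP; rewrite eq_le le energy_ge0.
apply/eqP; rewrite eq_le energy_ge0 andbT.
have CN : (C * energy f x) @[x --> p^'-] --> C * 0.
  by apply: cvgM; [exact: cvg_cst|rewrite -l0].
rewrite -(mulr0 C) -(cvg_lim (@Rhausdorff R) CN).
by apply: limr_ge; [apply/cvg_ex; eexists; exact: CN|apply: filterS HH => u []].
Unshelve. all: by end_near. Qed.

End OneSided.

Lemma locally_constant_on_interval (a b : \bar R) (w : R -> R) :
  (forall p, oint a b p -> \forall t \near p, w t = w p) ->
  forall s t, oint a b s -> oint a b t -> w s = w t.
Proof.
move=> loc.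
suff H : forall s t, oint a b s -> oint a b t -> s < t -> w t = w s.
  move=> s t Ds Dt; have [st|ts|->//] := ltgtP s t; first exact/esym/H.
  exact: H.
move=> s t [as_ _] [_ tb] st.
have D u : s <= u <= t -> oint a b u.
  move=> /andP[su ut]; split; first by apply: lt_le_trans as_ _; rewrite lee_fin.
  by apply: le_lt_trans tb; rewrite lee_fin.
have der u : s <= u <= t -> is_derive u 1 w 0.
  move=> /D /loc near_w.
  have eq : {near u, (cst (w u)) =1 w} by apply: filterS near_w => v ->.
  split; first by apply: near_eq_derivable eq _; exact: derivable_cst.
  by rewrite -(@near_eq_derive _ _ _ _ _ _ (1 : R^o) eq) derive_cst.
have [||u _ wE] := @MVT _ w (fun=> 0) s t st; last first.
  by move: wE; rewrite mul0r => /eqP; rewrite subr_eq0 => /eqP.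
- apply: continuous_in_subspaceT => u; rewrite inE /= in_itv /= => /der[du _].
  exact/differentiable_continuous/derivable1_diffP.
- by move=> u; rewrite in_itv /= => /andP[? ?]; apply: der; rewrite !ltW.
Qed.

End GluedSolutions.

(** * Solutions across the interfaces *)

Section Interfaces.
Context (R : realType) (V : R -> R) (E : R) (a b : \bar R).
Context (I : set int) (x : I -> R).
Hypothesis hV : locally_integrable (oint a b) V.
Hypothesis hx : forall t, oint a b t -> ~ limit_point (range x) t.
Implicit Types (A : I -> 'M[R]_2) (B : 'M[R]_2) (D : set R) (p t : R) (f g h : R -> R).

(** Determinant one. *)
Definition unimodular B : Prop := B 0 0 * B 1 1 - B 0 1 * B 1 0 = 1.

(** The Cauchy data of f have one-sided limits at p, and B maps the left one to
    the right one. *)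
Definition jump B f p : Prop := exists l dl r dr : R,
  [/\ f t @[t --> p^'-] --> l, derive1 f t @[t --> p^'-] --> dl,
      f t @[t --> p^'+] --> r, derive1 f t @[t --> p^'+] --> dr &
      r = B 0 0 * l + B 0 1 * dl /\ dr = B 1 0 * l + B 1 1 * dl].

(** Solutions in D away from the interfaces, subject to the interface conditions
    with matrices A n at those x n that lie in D. *)
Definition glued_solution D A f : Prop :=
  real_solution V E (D `\` range x) f /\ forall n, D (x n) -> jump (A n) f (x n).

(** The right limit, a total function of p, used to extend the Cauchy data across
    the interfaces. *)
Definition right_value f p : R := lim (f t @[t --> p^'+]).

Lemma right_valueE f p l : f t @[t --> p^'+] --> l -> right_value f p = l.
Proof. exact: cvg_lim. Qed.

Lemma punctured_neighborhood p : oint a b p ->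
  \forall e \near 0^'+, forall t, `|t - p| < e -> t != p -> ~ range x t.
Proof.
move=> /hx; rewrite /limit_point => H.
have [W nW HW] : exists2 W, nbhs p W & forall y, W y -> y != p -> ~ range x y.
  apply: contrapT => K; apply: H => W nW; apply: contrapT => K'.
  apply: K; exists W => // y Wy yp ry; apply: K'; exists y; split => //.
have /nbhs_ballP[r /= r0 rW] := nW.
near=> e => t te tp; apply: HW => //; apply: rW; rewrite /ball /= distrC.
by apply: lt_le_trans te _; near: e; exact: nbhs_right_le.
Unshelve. all: by end_near. Qed.

Lemma oint_open (u v : \bar R) : open (oint u v).
Proof.
rewrite (_ : oint u v = [set t | (u < t%:E)%E] `&` [set t | (t%:E < v)%E]).
  apply: openI.
    case: u => [u| |].
    - by rewrite (_ : [set t | _] = [set t : R | u < t])//; exact: open_gt.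
    - rewrite (_ : [set t | _] = set0) ?open0//.
      by apply/seteqP; split => t //=.
    - rewrite (_ : [set t | _] = setT); first exact: openT.
      by apply/seteqP; split => t //= _; rewrite ltNyr.
  case: v => [v| |].
  - by rewrite (_ : [set t | _] = [set t : R | t < v])//; exact: open_lt.
  - rewrite (_ : [set t | _] = setT); first exact: openT.
    by apply/seteqP; split => t //= _; rewrite ltry.
  - rewrite (_ : [set t | _] = set0) ?open0//.
    by apply/seteqP; split => t //=.
by apply/seteqP; split.
Qed.

Section OnInterval.
Variables (a' b' : \bar R) (A : I -> 'M[R]_2).
Let D := oint a' b'.
Hypothesis DO : D `<=` oint a b.
Hypothesis uniA : forall n, unimodular (A n).

Lemma local_neighborhood p : D p -> exists2 e, 0 < e &
  (forall t, `|t - p| <= e -> D t) /\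
  (forall t, `|t - p| < e -> t != p -> (D `\` range x) t).
Proof.
move=> Dp; have /nbhs_ballP[r /= r0 rD] := open_nbhs_nbhs (conj (@oint_open a' b') Dp).
near (0 : R)^'+ => e.
have e0 : 0 < e by near: e; exact: nbhs_right_gt.
have er : e < r by near: e; exact: nbhs_right_lt.
have H : forall t, `|t - p| < e -> t != p -> ~ range x t.
  by near: e; exact: punctured_neighborhood (DO Dp).
have HD t : `|t - p| <= e -> D t.
  by move=> te; apply: rD; rewrite /ball /= distrC; exact: le_lt_trans er.
exists e => //; split=> // t te tp; split; last exact: H.
by apply: HD; exact: ltW.
Unshelve. all: by end_near. Qed.

Lemma off_points_near p : D p -> ~ range x p -> \forall s \near p, (D `\` range x) s.
Proof.
move=> Dp rp; have [e e0 [_ H]] := local_neighborhood Dp.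
near=> s; have [->//|sp] := eqVneq s p; apply: (H _ _ sp).
by rewrite distrC; near: s; exact: cvgr_dist_lt.
Unshelve. all: by end_near. Qed.

Lemma glued_continuous f p : glued_solution D A f -> D p -> ~ range x p ->
  {for p, continuous f} /\ {for p, continuous (derive1 f)}.
Proof.
by move=> [sf _] Dp rp; apply: (real_solution_continuous sf); exact: off_points_near.
Qed.

(** At a point carrying no interface the transfer matrix is the identity. *)
Lemma jump_matrix p : D p ->
  exists2 B, unimodular B & forall f, glued_solution D A f -> jump B f p.
Proof.
move=> Dp; have [[n _ xn]|rp] := pselect (range x p).
  by exists (A n) => // f [_]; rewrite -xn; apply; rewrite xn.
exists 1%:M; first by rewrite /unimodular !mxE /=; ring.
move=> f gf; have [cf cdf] := glued_continuous gf Dp rp.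
exists (f p), (derive1 f p), (f p), (derive1 f p); split.
- exact: cvg_at_left_filter.
- exact: cvg_at_left_filter.
- exact: cvg_at_right_filter.
- exact: cvg_at_right_filter.
- by rewrite !mxE /=; split; ring.
Qed.

Lemma right_value_off f p : glued_solution D A f -> D p -> ~ range x p ->
  right_value f p = f p /\ right_value (derive1 f) p = derive1 f p.
Proof.
move=> gf Dp rp; have [cf cdf] := glued_continuous gf Dp rp.
by split; apply: right_valueE; exact: cvg_at_right_filter.
Qed.

(** The Wronskian formed with right limits is locally constant on the whole
    interval, since unimodular matrices preserve it. *)
Lemma glued_wronskian f g s t : glued_solution D A f -> glued_solution D A g ->
  (D `\` range x) s -> (D `\` range x) t -> wronskian f g s = wronskian f g t.
Proof.
move=> gf gg.
(* Off the interfaces w is the Wronskian. *)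
pose w p := right_value f p * right_value (derive1 g) p
          - right_value (derive1 f) p * right_value g p.
have wE p : (D `\` range x) p -> w p = wronskian f g p.
  move=> [Dp rp]; rewrite /w; have [-> ->] := right_value_off gf Dp rp.
  by have [-> ->] := right_value_off gg Dp rp.
move=> Us Ut; rewrite -!wE//.
apply: (locally_constant_on_interval (a := a') (b := b')); [|exact: Us.1|exact: Ut.1].
move=> p Dp; have [B uB jB] := jump_matrix Dp.
have [l [dl [r [dr [fl fdl fr fdr [rE drE]]]]]] := jB _ gf.
have [m [dm [q [dq [gm gdm gq gdq [qE dqE]]]]]] := jB _ gg.
have wp : w p = r * dq - dr * q by rewrite /w !(right_valueE fr, right_valueE fdr, right_valueE gq, right_valueE gdq).
have [e e0 [_ HU]] := local_neighborhood Dp.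
near=> u; have [->//|up] := eqVneq u p.
have ue : `|u - p| < e by rewrite distrC; near: u; exact: cvgr_dist_lt.
rewrite wE; last exact: HU.
have [sf _] := gf; have [sg _] := gg.
move: ue; rewrite ltr_norml => /andP[u1 u2].
have [pu|pu] : p < u \/ u < p by have [?|?] := ltP p u; [left|right; rewrite lt_neqAle up].
- rewrite wp; apply: (@wronskian_right_limit _ V E _ p e _ _ _ _ _ _ _ _ sf sg) => //; last by lra.
  by move=> v /andP[? ?]; apply: HU; rewrite ?ltr_norml ?gt_eqF//; apply/andP; split; lra.
- have -> : wronskian f g u = l * dm - dl * m.
    apply: (@wronskian_left_limit _ V E _ p e _ _ _ _ _ _ _ _ sf sg) => //; last by lra.
    by move=> v /andP[? ?]; apply: HU; rewrite ?ltr_norml ?lt_eqF//; apply/andP; split; lra.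
  by rewrite wp rE drE qE dqE -[LHS]mul1r -uB; ring.
Unshelve. all: by end_near. Qed.

(** Uniqueness for the initial value problem across the interfaces: vanishing of
    the right limits of the Cauchy data is a locally constant property. *)
Lemma glued_energy f s t : glued_solution D A f -> D s ->
  right_value f s = 0 -> right_value (derive1 f) s = 0 ->
  (D `\` range x) t -> f t = 0.
Proof.
move=> gf Ds f0 df0 [Dt rt].
pose z p := right_value f p ^+ 2 + right_value (derive1 f) p ^+ 2.
(* The indicator of the points with vanishing Cauchy data. *)
pose w p : R := (z p == 0)%:R.
have zE p : (D `\` range x) p -> z p = energy f p.
  by move=> [Dp rp]; rewrite /z; have [-> ->] := right_value_off gf Dp rp.
have : w t = w s.
  apply: (locally_constant_on_interval (a := a') (b := b')) => // p Dp.
  have [B uB jB] := jump_matrix Dp.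
  have [l [dl [r [dr [fl fdl fr fdr [rE drE]]]]]] := jB _ gf.
  have zp : z p = r ^+ 2 + dr ^+ 2 by rewrite /z (right_valueE fr) (right_valueE fdr).
  have [e e0 [HD HU]] := local_neighborhood Dp.
  near=> u; have [->//|up] := eqVneq u p.
  have ue : `|u - p| < e by rewrite distrC; near: u; exact: cvgr_dist_lt.
  rewrite /w zE; last exact: HU.
  have [sf _] := gf.
  move: ue; rewrite ltr_norml => /andP[u1 u2]; rewrite zp; congr (_ %:R); congr nat_of_bool.
  have [pu|pu] : p < u \/ u < p by have [?|?] := ltP p u; [left|right; rewrite lt_neqAle up].
  - apply: (@energy_right_limit _ V E _ hV _ p e _ _ _ _ _ _ _ sf) => //; last by lra.
      move=> v /=; rewrite in_itv /= => /andP[? ?]; apply/DO/HD.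
      by rewrite ler_norml; apply/andP; split; lra.
    by move=> v /andP[? ?]; apply: HU; rewrite ?ltr_norml ?gt_eqF//; apply/andP; split; lra.
  - have -> : (energy f u == 0) = (l ^+ 2 + dl ^+ 2 == 0).
      apply: (@energy_left_limit _ V E _ hV _ p e _ _ _ _ _ _ _ sf) => //; last by lra.
        move=> v /=; rewrite in_itv /= => /andP[? ?]; apply/DO/HD.
        by rewrite ler_norml; apply/andP; split; lra.
      by move=> v /andP[? ?]; apply: HU; rewrite ?ltr_norml ?lt_eqF//; apply/andP; split; lra.
    rewrite !paddr_eq0 ?sqr_ge0// !sqrf_eq0; apply/andP/andP => -[/eqP h1 /eqP h2].
      by rewrite rE drE h1 h2 !mulr0 addr0 eqxx.
    have -> : l = B 1 1 * r - B 0 1 * dr by rewrite rE drE -[LHS]mul1r -uB; ring.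
    have -> : dl = B 0 0 * dr - B 1 0 * r by rewrite rE drE -[LHS]mul1r -uB; ring.
    by rewrite h1 h2 !mulr0 subr0 eqxx.
have -> : w s = 1 by rewrite /w /z f0 df0 expr0n addr0 eqxx.
rewrite /w zE//; case: eqP => [|_ /esym/eqP]; last by rewrite oner_eq0.
move=> /eqP; rewrite /energy paddr_eq0 ?sqr_ge0// !sqrf_eq0.
by move=> /andP[/eqP].
Unshelve. all: by end_near. Qed.

End OnInterval.
End Interfaces.

(** * Square integrable solutions and dependence *)

Section SquareIntegrable.
Context (R : realType).
Implicit Types (D M : set R) (f g h : R -> R) (F : R -> R[i]).
Local Notation leb := (@lebesgue_measure R).

(** Square integrability of a real function on D. *)
Definition real_L2 D f : Prop :=
  measurable_fun D f /\ leb.-integrable D (fun t => (f t ^+ 2)%:E).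

Local Notation mR D := (measurable (D : set (measurableTypeR R))).

Lemma measurable_fun_sqr D f : mR D -> measurable_fun D f ->
  measurable_fun D (fun t => (f t ^+ 2)%:E).
Proof.
move=> mD mf; apply/measurable_EFinP.
by under eq_fun do rewrite expr2; exact: measurable_funM.
Qed.

Lemma square_integrable_real_L2 D F : mR D -> square_integrable D F <->
  real_L2 D (fun t => complex.Re (F t)) /\ real_L2 D (fun t => complex.Im (F t)).
Proof.
move=> mD; split=> [[mRe mIm intF]|[[mRe iRe] [mIm iIm]]].
  by split; split => //; apply: le_integrable intF => //; try exact: measurable_fun_sqr;
    move=> t _; rewrite /= lee_fin !ger0_norm ?addr_ge0 ?sqr_ge0// ?lerDl ?lerDr ?sqr_ge0.
split => //.
have := integrableD mD iRe iIm; exact: eq_integrable.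
Qed.

Lemma real_L2_sub D D' f : mR D -> mR D' -> D' `<=` D ->
  real_L2 D f -> real_L2 D' f.
Proof.
move=> mD mD' DD [mf intf]; split; first exact: measurable_funS mf.
exact: integrableS intf.
Qed.

(** Square integrability of h follows from an identity that holds off a countable
    set, where the values of h are arbitrary. *)
Lemma real_L2_linear_combination D M f g h (c1 c2 : R) : mR D ->
  countable M -> real_L2 D f -> real_L2 D g ->
  (forall t, (D `\` M) t -> h t = c1 * f t + c2 * g t) -> real_L2 D h.
Proof.
move=> mD cM [mf intf] [mg intg] hE.
have mC (C : set R) : countable C -> mR C.
  by apply: countable_measurable => t; exact: measurable_set1.
have mM := mC _ cM; have mDM : mR (D `\` M) by exact: measurableD.
pose k t := c1 * f t + c2 * g t.
have mk : measurable_fun D k.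
  by apply: measurable_funD; apply: measurable_funM => //; exact: measurable_cst.
have mh : measurable_fun D h.
  have -> : D = (D `\` M) `|` (D `&` M).
    apply/seteqP; split => t; last by case=> -[].
    by move=> Dt; have [Mt|Mt] := pselect (M t); [right|left].
  apply/measurable_funU => //; first exact: measurableI.
  split.
    apply: (eq_measurable_fun k); last exact: measurable_funS mk.
    by move=> t; rewrite inE => /hE ->.
  move=> mDI Y mY; apply: mC; apply: sub_countable cM.
  by apply: subset_card_le => t [[]].
split => //.
apply/(negligible_integrable mM mD); first exact: measurable_fun_sqr.
  exact: countable_lebesgue_measure0.
have intk : leb.-integrable (D `\` M)
    (fun t => ((2 * c1 ^+ 2)%:E * (f t ^+ 2)%:E + (2 * c2 ^+ 2)%:E * (g t ^+ 2)%:E)%E).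
  apply: integrableS (mD) mDM _ _; first by move=> t [].
  by apply: integrableD => //; apply: integrableZl.
apply: le_integrable intk => //.
  by apply: measurable_fun_sqr => //; exact: measurable_funS mh.
move=> t Ut; rewrite /= lee_fin (hE _ Ut).
rewrite ger0_norm ?sqr_ge0// ger0_norm; last first.
  by rewrite addr_ge0// mulr_ge0 ?sqr_ge0// mulr_ge0 ?sqr_ge0.
by have := sqr_ge0 (c1 * f t - c2 * g t); rewrite sqrrB sqrrD !exprMn; lra.
Qed.

End SquareIntegrable.

Section Dependence.
Context (R : realType) (V : R -> R) (E : R) (a b : \bar R).
Context (I : set int) (x : I -> R).
Hypothesis hx : forall t, oint a b t -> ~ limit_point (range x) t.
Variables (a' b' : \bar R) (A : I -> 'M[R]_2).
Let D := oint a' b'.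
Hypothesis DO : D `<=` oint a b.
Hypothesis uniA : forall n, unimodular (A n).
Implicit Types (f g h : R -> R) (t : R).

Lemma countable_points : countable (range x).
Proof. exact: sub_countable (card_image_le _ _) (countableP _). Qed.

(** Two square integrable solutions with nonvanishing Wronskian would make
    every solution square integrable. *)
Lemma dependent_of_limit_point f g h t :
  glued_solution V E x D A f -> glued_solution V E x D A g ->
  glued_solution V E x D A h -> real_L2 D f -> real_L2 D g ->
  (D `\` range x) t -> wronskian f g t != 0 -> real_L2 D h.
Proof.
move=> gf gg gh Lf Lg Ut W0.
have mD : measurable (D : set (measurableTypeR R)) by apply: open_measurable; exact: oint_open.
apply: (@real_L2_linear_combination _ D (range x) f g h
  (wronskian h g t / wronskian f g t) (wronskian f h t / wronskian f g t)) => //.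
  exact: countable_points.
(* Pointwise, W(f, g) h = W(h, g) f + W(f, h) g. *)
move=> s Us.
have Wc u v := @glued_wronskian _ V E a b I x hx a' b' A DO uniA u v s t.
rewrite -(Wc _ _ gf gg Us Ut) in W0 *.
rewrite -(Wc _ _ gh gg Us Ut) -(Wc _ _ gf gh Us Ut).
by move: W0; rewrite /wronskian => W0; field.
Qed.

(** Two solutions with the same boundary condition along F have zero Wronskian. *)
Lemma dependent_of_boundary_condition (F : set_system R) (FF : ProperFilter F)
    (psi : R) f g t (f0 df0 g0 dg0 : R) :
  F (D `\` range x) ->
  glued_solution V E x D A f -> glued_solution V E x D A g ->
  f s @[s --> F] --> f0 -> derive1 f s @[s --> F] --> df0 ->
  g s @[s --> F] --> g0 -> derive1 g s @[s --> F] --> dg0 ->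
  f0 * cos psi + df0 * sin psi = 0 -> g0 * cos psi + dg0 * sin psi = 0 ->
  (D `\` range x) t -> wronskian f g t = 0.
Proof.
move=> FD gf gg ff fdf fg fdg bf bg Ut.
have W : wronskian f g s @[s --> F] --> f0 * dg0 - df0 * g0.
  by apply: cvgB; apply: cvgM.
have -> : wronskian f g t = f0 * dg0 - df0 * g0.
  apply/esym/(near_constant_limit FF W); apply: filterS FD => s Us.
  exact: (@glued_wronskian _ V E a b I x hx a' b' A DO uniA).
have : (f0 * dg0 - df0 * g0) * (cos psi ^+ 2 + sin psi ^+ 2) = 0.
  have -> : (f0 * dg0 - df0 * g0) * (cos psi ^+ 2 + sin psi ^+ 2) =
    (f0 * cos psi + df0 * sin psi) * (dg0 * cos psi - g0 * sin psi)
    - (g0 * cos psi + dg0 * sin psi) * (df0 * cos psi - f0 * sin psi) by ring.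
  by rewrite bf bg !mul0r subr0.
by rewrite cos2Dsin2 mulr1.
Qed.

End Dependence.

(** * From complex to real solutions *)

Section RealParts.
Context (R : realType) (V : R -> R) (E : R) (a b : \bar R).
Context (I : set int) (x : I -> R).
Implicit Types (F : R -> R[i]) (D : set R) (t : R).

Lemma interface_mx_unimodular (al r th : R) : 0 < r -> unimodular (interface_mx al r th).
Proof.
move=> r0; rewrite /unimodular /interface_mx !mxE !big_ord_recl !big_ord0 !mxE /=.
rewrite !big_ord_recl !big_ord0 !mxE /= -[RHS](cos2Dsin2 th).
by field; rewrite gt_eqF.
Qed.

Lemma col2_mulmx (B : 'M[R]_2) (p q u v : R[i]) :
  col2 p q = map_mx (real_complex R) B *m col2 u v ->
  (p = (B 0 0)%:C * u + (B 0 1)%:C * v) /\ (q = (B 1 0)%:C * u + (B 1 1)%:C * v).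
Proof.
move=> /matrixP H; have := H 0 0; have := H 1 0.
rewrite !mxE !big_ord_recl !big_ord0 !mxE /= !addr0.
by rewrite (_ : lift 0 0 = 1)//; apply/val_inj.
Qed.

(** The matrices A_(alpha, r, theta) at all interfaces. *)
Definition interface_matrices (Lambda : I -> R) (Rho : I -> {posnum R}) (Theta : I -> R) n :=
  interface_mx (Lambda n) (Rho n)%:num (Theta n).

(** Real and imaginary parts of a complex solution are real solutions, since V, E
    and the interface matrices are real. *)
Lemma real_parts_glued Lambda Rho Theta F D : D `<=` oint a b ->
  piecewise_ac a b x F ->
  ae_eq_on (oint a b) (tau V F) (fun t => E%:C * F t) ->
  interface_conditions x Lambda Rho Theta F ->
  glued_solution V E x D (interface_matrices Lambda Rho Theta) (fun t => complex.Re (F t)) /\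
  glued_solution V E x D (interface_matrices Lambda Rho Theta) (fun t => complex.Im (F t)).
Proof.
move=> DO [dF acF acdF] eqF jF.
have DU : D `\` range x `<=` oint a b `\` range x by move=> t [/DO].
split; split.
- split.
  + by move=> t /DU /dF[].
  + move=> c d cd cdU; have cdU' := subset_trans cdU DU.
    by split; [have [] := acF _ _ cd cdU'|have [] := acdF _ _ cd cdU'].
  + move: eqF; apply: filterS => t H /DU[/H + _]; rewrite /tau /cderive /=.
    by case: (F t) => u v /= [h _]; move: h; rewrite !(mul0r, subr0) => h; lra.
- move=> n _; have [fl [dfl [fr [dfr [[l _] [dl _] [r _] [dr _] eq]]]]] := jF n.
  exists (complex.Re fl), (complex.Re dfl), (complex.Re fr), (complex.Re dfr).
  split => //; have [-> ->] := col2_mulmx eq.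
  by case: (fl) (dfl) => u v [u' v'] /=; split; ring.
- split.
  + by move=> t /DU /dF[].
  + move=> c d cd cdU; have cdU' := subset_trans cdU DU.
    by split; [have [] := acF _ _ cd cdU'|have [] := acdF _ _ cd cdU'].
  + move: eqF; apply: filterS => t H /DU[/H + _]; rewrite /tau /cderive /=.
    by case: (F t) => u v /= [_ h]; move: h; rewrite !(mul0r, addr0) => h; lra.
- move=> n _; have [fl [dfl [fr [dfr [[_ l] [_ dl] [_ r] [_ dr] eq]]]]] := jF n.
  exists (complex.Im fl), (complex.Im dfl), (complex.Im fr), (complex.Im dfr).
  split => //; have [-> ->] := col2_mulmx eq.
  by case: (fl) (dfl) => u v [u' v'] /=; split; ring.
Qed.

End RealParts.

(** * Eigenfunctions and the angle at an interface *)

Section Eigenfunctions.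
Context (R : realType) (V : R -> R) (E : R) (a b : \bar R).
Context (I : set int) (x : I -> R) (psia psib : R).
Hypothesis hV : locally_integrable (oint a b) V.
Hypothesis hx : admissible_points a b x.
Implicit Types (Lambda Theta : I -> R) (Rho : I -> {posnum R}) (f g : R -> R) (t : R).
Local Notation leb := (@lebesgue_measure R).
Local Notation O := (oint a b).

Let hlim t : O t -> ~ limit_point (range x) t.
Proof. by case: hx => _ _; exact. Qed.

Let xO n : O (x n). Proof. by case: hx. Qed.

Let xinj : injective x. Proof. by case: hx. Qed.

(** The boundary condition with angle psi, the boundary values being limits
    along F. *)
Definition real_boundary_condition (F : set_system R) (psi : R) f : Prop :=
  exists f0 df0 : R, [/\ f t @[t --> F] --> f0, derive1 f t @[t --> F] --> df0 &
    f0 * cos psi + df0 * sin psi = 0].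

(** Real functions in the domain of the operator that satisfy the eigenvalue
    equation for E and are not almost everywhere zero; the glueing property is
    recorded for every subset D of the interval. *)
Definition real_eigenfunction Lambda Rho Theta f : Prop :=
  [/\ real_L2 O f,
      forall D, D `<=` O -> glued_solution V E x D (interface_matrices Lambda Rho Theta) f,
      ~ {ae leb, forall t, O t -> f t = 0} &
      (regular_left a b V x -> real_boundary_condition (fine a)^'+ psia f) /\
      (regular_right a b V x -> real_boundary_condition (fine b)^'- psib f)].

Lemma measurable_oint (u v : \bar R) : measurable (oint u v : set (measurableTypeR R)).
Proof. by apply: open_measurable; exact: oint_open. Qed.

Lemma boundary_condition_real (F : set_system R) (psi : R) (g : R -> R[i]) :
  boundary_condition F psi g ->
  real_boundary_condition F psi (fun t => complex.Re (g t)) /\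
  real_boundary_condition F psi (fun t => complex.Im (g t)).
Proof.
move=> [[u u'] [[v v'] [[/= fu fu'] [/= fv fv'] /eqP]]].
rewrite eq_complex => /andP[/eqP /= h /eqP /= h'].
split; [exists u, v|exists u', v']; split => //; first by rewrite -[RHS]h; ring.
by rewrite -[RHS]h'; ring.
Qed.

Lemma exists_real_eigenfunction Lambda Rho Theta :
  H_point_spectrum a b V x psia psib Lambda Rho Theta E%:C ->
  exists f, real_eigenfunction Lambda Rho Theta f.
Proof.
move=> [g [[L2g pac _ jg [bl br]] g0 eqg]].
have [LRe LIm] : real_L2 O (fun t => complex.Re (g t)) /\ real_L2 O (fun t => complex.Im (g t)).
  by apply/square_integrable_real_L2 => //; exact: measurable_oint.
have glued D (DO : D `<=` O) := real_parts_glued DO pac eqg jg.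
(* One of the real and imaginary parts is not almost everywhere zero. *)
have [Re0|Re0] := pselect {ae leb, forall t, O t -> complex.Re (g t) = 0}; last first.
  exists (fun t => complex.Re (g t)); split => //; first by move=> D /glued[].
  by split => [/bl|/br] /boundary_condition_real[].
have [Im0|Im0] := pselect {ae leb, forall t, O t -> complex.Im (g t) = 0}; last first.
  exists (fun t => complex.Im (g t)); split => //; first by move=> D /glued[].
  by split => [/bl|/br] /boundary_condition_real[].
exfalso; apply: g0; move: Re0 Im0; apply: filterS2 => t Re0 Im0 Ot.
by have := Re0 Ot; have := Im0 Ot; case: (g t) => u v /= -> ->.
Qed.

Lemma glued_eq_matrices D (A B : I -> 'M[R]_2) f :
  (forall n, D (x n) -> A n = B n) -> glued_solution V E x D A f ->
  glued_solution V E x D B f.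
Proof. by move=> AB [sf jf]; split=> // n Dn; rewrite -AB//; exact: jf. Qed.

(** The limit point alternative on a subinterval next to an endpoint: if some
    solution F is not square integrable there, then any two square integrable
    solutions f, g have zero Wronskian. *)
Lemma limit_point_dependent Lambda Rho Theta (u v : \bar R) f g t (F : R -> R[i]) :
  oint u v `<=` O ->
  glued_solution V E x (oint u v) (interface_matrices Lambda Rho Theta) f ->
  glued_solution V E x (oint u v) (interface_matrices Lambda Rho Theta) g ->
  real_L2 O f -> real_L2 O g ->
  solution a b V x Lambda Rho Theta E%:C F -> ~ square_integrable (oint u v) F ->
  (oint u v `\` range x) t -> wronskian f g t = 0.
Proof.
move=> DO gf gg Lf Lg [pac eq jF] nL Ut.
apply/eqP/negPn/negP => W0; apply: nL.
have eq' : ae_eq_on O (tau V F) (fun t => E%:C * F t).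
  by move: eq; apply: filterS => s H /H /eqP; rewrite subr_eq0 => /eqP.
have [gRe gIm] := real_parts_glued DO pac eq' jF.
have uniA n : unimodular (interface_matrices Lambda Rho Theta n).
  by apply: interface_mx_unimodular.
have Lf' := real_L2_sub (measurable_oint a b) (measurable_oint u v) DO Lf.
have Lg' := real_L2_sub (measurable_oint a b) (measurable_oint u v) DO Lg.
apply/square_integrable_real_L2; first exact: measurable_oint.
by split; apply: (dependent_of_limit_point hlim DO uniA gf gg) Ut W0.
Qed.

Section TwoAngles.
Variables (Lambda : I -> R) (Rho : I -> {posnum R}) (Theta1 Theta2 : I -> R) (n0 : I).
Hypothesis eqTheta : forall n, n != n0 -> Theta1 n = Theta2 n.
Hypothesis hleft : regular_left a b V x \/ limit_point_case_left a b V x Lambda Rho Theta1.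
Hypothesis hright : regular_right a b V x \/ limit_point_case_right a b V x Lambda Rho Theta1.
Variables (f1 f2 : R -> R).
Hypothesis ef1 : real_eigenfunction Lambda Rho Theta1 f1.
Hypothesis ef2 : real_eigenfunction Lambda Rho Theta2 f2.
Let A := interface_matrices Lambda Rho Theta1.
Let Dl := oint a (x n0)%:E.
Let Dr := oint (x n0)%:E b.

Let uniA n : unimodular (A n). Proof. exact: interface_mx_unimodular. Qed.

Let DlO : Dl `<=` O.
Proof.
move=> t [at_ tx]; split => //; have [_ xb] := xO n0; exact: lt_trans xb.
Qed.

Let DrO : Dr `<=` O.
Proof.
move=> t [xt tb]; split => //; have [ax _] := xO n0; exact: lt_trans xt.
Qed.

Let f2_glued D : D `<=` O -> ~ D (x n0) -> glued_solution V E x D A f2.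
Proof.
move=> DO nD; have [_ /(_ _ DO) g _ _] := ef2.
apply: glued_eq_matrices g => n Dn; rewrite /A /interface_matrices eqTheta//.
by apply/eqP => nn; apply: nD; rewrite -nn.
Qed.

Let nDl : ~ Dl (x n0). Proof. by move=> [_]; rewrite ltxx. Qed.
Let nDr : ~ Dr (x n0). Proof. by move=> []; rewrite ltxx. Qed.

(** To the left of x n0 the angle at n0 plays no role: f1 and f2 solve the same
    problem. *)
Lemma wronskian_left t : (Dl `\` range x) t -> wronskian f1 f2 t = 0.
Proof.
move=> Ut; have [L1 /(_ _ DlO) g1 _ [bc1 _]] := ef1; have [L2 _ _ [bc2 _]] := ef2.
have g2 := f2_glued DlO nDl.
have [reg|/(_ E%:C)[F sF nF]] := hleft; last first.
  apply: (limit_point_dependent DlO g1 g2 L1 L2 sF) Ut => HF.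
  by apply: nF; exists (x n0).
have [p [dp [fp fdp bp]]] := bc1 reg; have [q [dq [fq fdq bq]]] := bc2 reg.
apply: (@dependent_of_boundary_condition _ V E a b I x hlim a (x n0)%:E A DlO uniA
  (fine a)^'+ _ psia f1 f2 t p dp q dq) => //.
have [afin _ nlim] := reg.
have [W nW HW] : exists2 W, nbhs (fine a) W & forall y, W y -> y != fine a -> ~ range x y.
  apply: contrapT => K; apply: nlim => W nW; apply: contrapT => K'.
  by apply: K; exists W => // y Wy yp ry; apply: K'; exists y; split.
have /nbhs_ballP[r /= r0 rW] := nW.
have aE : a = (fine a)%:E by rewrite fineK.
have ax : fine a < x n0 by have [] := xO n0; rewrite aE lte_fin.
near=> s.
have as_ : fine a < s by near: s; exact: nbhs_right_gt.
have sr : s < fine a + r by near: s; apply: nbhs_right_lt; lra.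
split.
  split; first by rewrite aE lte_fin.
  by rewrite lte_fin; near: s; exact: nbhs_right_lt.
apply: HW; last by rewrite gt_eqF.
by apply: rW; rewrite /ball /= ltr_norml; apply/andP; split; lra.
Unshelve. all: by end_near. Qed.

Lemma wronskian_right t : (Dr `\` range x) t -> wronskian f1 f2 t = 0.
Proof.
move=> Ut; have [L1 /(_ _ DrO) g1 _ [_ bc1]] := ef1; have [L2 _ _ [_ bc2]] := ef2.
have g2 := f2_glued DrO nDr.
have [reg|/(_ E%:C)[F sF nF]] := hright; last first.
  apply: (limit_point_dependent DrO g1 g2 L1 L2 sF) Ut => HF.
  by apply: nF; exists (x n0).
have [p [dp [fp fdp bp]]] := bc1 reg; have [q [dq [fq fdq bq]]] := bc2 reg.
apply: (@dependent_of_boundary_condition _ V E a b I x hlim (x n0)%:E b A DrO uniA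
  (fine b)^'- _ psib f1 f2 t p dp q dq) => //.
have [bfin _ nlim] := reg.
have [W nW HW] : exists2 W, nbhs (fine b) W & forall y, W y -> y != fine b -> ~ range x y.
  apply: contrapT => K; apply: nlim => W nW; apply: contrapT => K'.
  by apply: K; exists W => // y Wy yp ry; apply: K'; exists y; split.
have /nbhs_ballP[r /= r0 rW] := nW.
have bE : b = (fine b)%:E by rewrite fineK.
have xb : x n0 < fine b by have [_] := xO n0; rewrite {1}bE lte_fin.
near=> s.
have sb : s < fine b by near: s; exact: nbhs_left_lt.
have sr : fine b - r < s by near: s; apply: nbhs_left_gt; lra.
split.
  split; last by rewrite {1}bE lte_fin.
  by rewrite lte_fin; near: s; exact: nbhs_left_gt.
apply: HW; last by rewrite lt_eqF.
by apply: rW; rewrite /ball /= ltr_norml; apply/andP; split; lra.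
Unshelve. all: by end_near. Qed.

End TwoAngles.

(** The left limits at an interface of the Cauchy data of an eigenfunction are
    not both zero: by uniqueness, the eigenfunction would vanish. *)
Lemma eigenfunction_left_limit_neq0 Lambda Rho Theta f n (l dl : R) :
  real_eigenfunction Lambda Rho Theta f ->
  f t @[t --> (x n)^'-] --> l -> derive1 f t @[t --> (x n)^'-] --> dl ->
  l ^+ 2 + dl ^+ 2 != 0.
Proof.
move=> [_ /(_ O (@subset_refl _ _)) gf f0 _] fl fdl; apply/negP.
rewrite paddr_eq0 ?sqr_ge0// !sqrf_eq0 => /andP[/eqP l0 /eqP dl0]; apply: f0.
have uniA m : unimodular (interface_matrices Lambda Rho Theta m).
  exact: interface_mx_unimodular.
have [_ /(_ n (xO n))[l' [dl' [r [dr [fl' fdl' fr fdr [rE drE]]]]]]] := gf.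
have l'0 : l' = 0 by rewrite -(cvg_lim (@Rhausdorff R) fl') -l0; exact: cvg_lim.
have dl'0 : dl' = 0 by rewrite -(cvg_lim (@Rhausdorff R) fdl') -dl0; exact: cvg_lim.
have r0 : r = 0 by rewrite rE l'0 dl'0 !mulr0 addr0.
have dr0 : dr = 0 by rewrite drE l'0 dl'0 !mulr0 addr0.
have mM : measurable (range x : set (measurableTypeR R)).
  by apply: countable_measurable => [t|]; [exact: measurable_set1|exact: countable_points].
exists (range x); split => //; first exact/countable_lebesgue_measure0/countable_points.
move=> t /= nt; apply: contrapT => rt; apply: nt => Ot.
apply: (@glued_energy _ V E a b I x hV hlim a b _ (@subset_refl _ _) uniA f (x n) t gf) => //.
- by rewrite (right_valueE fr).
- by rewrite (right_valueE fdr).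
Qed.

(** The rotation angle at an interface for which E is an eigenvalue is
    determined modulo pi by the remaining parameters. *)
Lemma eigenvalue_angle Lambda Rho Theta1 Theta2 n0 :
  (forall n, n != n0 -> Theta1 n = Theta2 n) ->
  regular_left a b V x \/ limit_point_case_left a b V x Lambda Rho Theta1 ->
  regular_right a b V x \/ limit_point_case_right a b V x Lambda Rho Theta1 ->
  H_point_spectrum a b V x psia psib Lambda Rho Theta1 E%:C ->
  H_point_spectrum a b V x psia psib Lambda Rho Theta2 E%:C ->
  sin (Theta2 n0 - Theta1 n0) = 0.
Proof.
move=> eqT hl hr /exists_real_eigenfunction[f1 ef1] /exists_real_eigenfunction[f2 ef2].
have [_ /(_ O (@subset_refl _ _)) gf1 _ _] := ef1.
have [_ /(_ O (@subset_refl _ _)) gf2 _ _] := ef2.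
have [_ /(_ n0 (xO n0))[l [dl [r [dr [fl fdl fr fdr [rE drE]]]]]]] := gf1.
have [_ /(_ n0 (xO n0))[m [dm [q [dq [gm gdm gq gdq [qE dqE]]]]]]] := gf2.
have l0 := eigenfunction_left_limit_neq0 ef1 fl fdl.
have m0 := eigenfunction_left_limit_neq0 ef2 gm gdm.
have [e e0 [eO eU]] := local_neighborhood hlim (@subset_refl _ _) (xO n0).
(* The left limits of the Cauchy data are parallel, and so are the right ones. *)
have Wl : l * dm - dl * m = 0.
  have W : wronskian f1 f2 t @[t --> (x n0)^'-] --> l * dm - dl * m.
    by apply: cvgB; apply: cvgM.
  apply: (near_constant_limit _ W); near=> t.
  have tx : t < x n0 by near: t; exact: nbhs_left_lt.
  have te : x n0 - e < t by near: t; apply: nbhs_left_gt; lra.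
  have [[at_ tb] rt] : (O `\` range x) t.
    by apply: eU; rewrite ?lt_eqF// ltr_norml; apply/andP; split; lra.
  by apply: (wronskian_left eqT hl ef1 ef2); split => //; split => //; rewrite lte_fin.
have Wr : r * dq - dr * q = 0.
  have W : wronskian f1 f2 t @[t --> (x n0)^'+] --> r * dq - dr * q.
    by apply: cvgB; apply: cvgM.
  apply: (near_constant_limit _ W); near=> t.
  have tx : x n0 < t by near: t; exact: nbhs_right_gt.
  have te : t < x n0 + e by near: t; apply: nbhs_right_lt; lra.
  have [[at_ tb] rt] : (O `\` range x) t.
    by apply: eU; rewrite ?gt_eqF// ltr_norml; apply/andP; split; lra.
  by apply: (wronskian_right eqT hr ef1 ef2); split => //; split => //; rewrite lte_fin.
have rho0 : (Rho n0)%:num != 0 by rewrite gt_eqF.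
(* Wr, pulled back through the two matrices, which share the unimodular factor
   to the left of the rotation. *)
have key : sin (Theta2 n0 - Theta1 n0) * (l * m + dl * dm) = 0.
  transitivity (sin (Theta2 n0 - Theta1 n0) * (l * m + dl * dm)
      + cos (Theta2 n0 - Theta1 n0) * (l * dm - dl * m)).
    by rewrite Wl mulr0 addr0.
  rewrite -[RHS]Wr rE drE qE dqE /interface_matrices /interface_mx.
  rewrite !mxE !big_ord_recl !big_ord0 !mxE /= !big_ord_recl !big_ord0 !mxE /=.
  rewrite sinB cosB.
  by field.
(* For parallel nonzero vectors the scalar product does not vanish. *)
have : (l * m + dl * dm) ^+ 2 = (l ^+ 2 + dl ^+ 2) * (m ^+ 2 + dm ^+ 2).
  transitivity ((l ^+ 2 + dl ^+ 2) * (m ^+ 2 + dm ^+ 2) - (l * dm - dl * m) ^+ 2); first by ring.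
  by rewrite Wl expr0n subr0.
move: key => /eqP; rewrite mulf_eq0 => /orP[/eqP//|/eqP ->] /eqP.
by rewrite expr0n eq_sym mulf_eq0 (negPf l0) (negPf m0).
Unshelve. all: by end_near. Qed.

End Eigenfunctions.

(** * Zeros of the sine function *)

Section SineZeros.
Context (R : realType).

Lemma sin_eq0_natmul (z : R) : 0 <= z -> sin z = 0 -> exists n : nat, z = pi *+ n.
Proof.
move=> z0 sz; pose n := Num.truncn (z / pi).
have pi0 : 0 < (pi : R) := pi_gt0 R.
have := truncn_itv (divr_ge0 z0 (ltW pi0)); rewrite -/n => /andP[nz zn].
have nz' : pi *+ n <= z by rewrite -mulr_natl -ler_pdivlMr.
have zn' : z < pi *+ n + pi by rewrite -mulrSr -mulr_natl -ltr_pdivrMr.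
have sn k (y : R) : sin (y + pi *+ k) = (-1) ^+ k * sin y.
  elim: k => [|k ih]; first by rewrite mulr0n addr0 expr0 mul1r.
  by rewrite mulrSr addrA sinDpi ih exprS mulN1r mulNr.
exists n; apply/eqP; rewrite eq_sym eq_le nz' /=.
have [//|lt] := leP z (pi *+ n).
have : 0 < sin (z - pi *+ n) by apply: sin_gt0_pi; apply/andP; split; lra.
have := sn n (z - pi *+ n); rewrite subrK sz => /esym/eqP.
by rewrite mulf_eq0 signr_eq0 /= => /eqP ->; rewrite ltxx.
Qed.

Lemma countable_sin_zeros (s : R) : countable [set t | sin (t - s) = 0].
Proof.
pose h (k : bool * nat) := if k.1 then s + pi *+ k.2 else s - pi *+ k.2.
have ch : countable (range h).
  exact: sub_countable (card_image_le _ _) (countableP _).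
apply: sub_countable ch; apply: subset_card_le => t /= st.
have [ts|ts] := leP 0 (t - s).
  by have [n nE] := sin_eq0_natmul ts st; exists (true, n) => //; rewrite /h /= -nE addrC subrK.
have [||n nE] := @sin_eq0_natmul (s - t); first by lra.
  by rewrite -opprB sinN st oppr0.
by exists (false, n) => //; rewrite /h /= -nE; lra.
Qed.

End SineZeros.

(** * Product probabilities and resampling of a coordinate *)

Section ProductMeasures.
Context (R : realType).

Lemma measure_countable0 d (T : measurableType d) (m : {measure set T -> \bar R}) (A : set T) :
  (forall t, measurable ([set t] : set T)) -> (forall t, m [set t] = 0%E) -> countable A ->
  m A = 0%E.
Proof.
move=> mset m0 cA; have mA := countable_measurable mset cA.
have /countable_injP[f injf] := cA.
pose B n := A `&` [set t | f t = n].
have B01 n : B n = set0 \/ exists t, B n = [set t].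
  have [[t [At ft]]|B0] := pselect (B n !=set0); last by left; by apply/eqP/negPn/negP => /set0P.
  right; exists t; apply/seteqP; split => [s [As fs]|s ->] //=.
  by apply: injf; rewrite ?inE//= ft fs.
have mB n : measurable (B n) by have [->|[t ->]] := B01 n.
apply/eqP; rewrite eq_le measure_ge0 andbT.
apply: (@le_trans _ _ (\sum_(0 <= n <oo) m (B n))%E).
  by apply: measure_sigma_subadditive => // t At; exists (f t).
rewrite eseries0// => n _ _.
by have [->|[t ->]] := B01 n; rewrite ?measure0 ?m0.
Qed.

Context (I : choiceType) (d : measure_display) (T : measurableType d).
Local Notation S := (sequence_space I T).

(** A measurable box, constrained in the coordinates from J only. *)
Definition box (J : seq I) (B : I -> set T) : set S :=
  [set w | forall i, i \in J -> B i (w i)].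

Definition boxes : set (set S) :=
  [set C | exists J B, [/\ uniq J, forall i, measurable (B i) & C = box J B]].

Lemma measurable_coordinate (i : I) (B : set T) : measurable B ->
  measurable ([set w | B (w i)] : set S).
Proof. by move=> mB; apply: sub_sigma_algebra; exists i, B. Qed.

Lemma measurable_box J B : (forall i, measurable (B i)) -> measurable (box J B).
Proof.
move=> mB; elim: J => [|i J ih].
  by rewrite (_ : box _ _ = setT)//; apply/seteqP; split.
rewrite (_ : box _ _ = [set w | B i (w i)] `&` box J B).
  by apply: measurableI => //; exact: measurable_coordinate.
apply/seteqP; split => w.
  by move=> H; split=> [|j jJ]; apply: H; rewrite inE ?eqxx ?jJ ?orbT.
by move=> [wi H] j; rewrite inE => /predU1P[->//|]; exact: H.
Qed.

Lemma measurable_boxes : @measurable _ S = <<s boxes >>.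
Proof.
apply/seteqP; split.
  apply: smallest_sub; first exact: smallest_sigma_algebra.
  move=> C [i [B mB ->]]; apply: sub_sigma_algebra; exists [:: i], (fun=> B).
  split => //; apply/seteqP; split => w /= H; last by apply: H; rewrite inE.
  by move=> j; rewrite inE => /eqP ->.
apply: smallest_sub; first exact: sigma_algebra_measurable.
by move=> C [J [B [_ mB ->]]]; exact: measurable_box.
Qed.

Lemma boxes_setI : setI_closed boxes.
Proof.
move=> _ _ [J1 [B1 [_ mB1 ->]]] [J2 [B2 [_ mB2 ->]]].
exists (undup (J1 ++ J2)), (fun i => (if i \in J1 then B1 i else setT) `&`
  (if i \in J2 then B2 i else setT)); split; first exact: undup_uniq.
  by move=> i; apply: measurableI; case: ifP.
apply/seteqP; split => w.
  by move=> [H1 H2] i _; split; case: ifP => // ?; [exact: H1|exact: H2].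
move=> H; split => i iJ; have := H i; rewrite mem_undup mem_cat iJ ?orbT => /(_ isT)[] //.
Qed.

(** Resampling one coordinate. *)
Definition resample (n : I) (p : S * T) : S :=
  fun i => if i == n then p.2 else p.1 i.

Lemma measurable_resample n : measurable_fun setT (resample n).
Proof.
apply: (@measurability _ _ _ S setT (resample n) (@coordinate_sets I d T) erefl).
move=> _ [_ [i [B mB ->]] <-]; rewrite setTI.
rewrite (_ : _ @^-1` _ = if i == n then setT `*` B else [set w | B (w i)] `*` setT).
  case: ifP => _; apply: measurableX => //; exact: measurable_coordinate.
by apply/seteqP; split => -[w t]; rewrite /resample /=; case: eqP => //= ?; tauto.
Qed.

Variables (p : I -> probability T R) (P : probability S R).
Hypothesis hP : is_product_probability p P.

(** Under a product probability, resampling one coordinate independently with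
    its own marginal does not change the law. *)
Lemma resample_law n (A : set S) : measurable A ->
  P A = (P \x p n)%E (resample n @^-1` A).
Proof.
move=> mA.
have mr := measurable_resample n.
have hPbox J B : uniq J -> (forall i, measurable (B i)) ->
  P (box J B) = (\prod_(i <- J) p i (B i))%E by exact: hP.
pose m2 : {measure set S -> \bar R} := pushforward (P \x p n)%E (resample n).
have := @measure_unique _ R S boxes (fun=> setT) measurable_boxes boxes_setI _ _ P (m2 mr).
apply => //.
- move=> _; exists [::], (fun=> setT); split => //.
  by apply/seteqP; split.
- by apply/seteqP; split => // w _; exists 0%N.
- move=> _ [J [B [uJ mB ->]]]; apply: (eq_trans (hPbox J B uJ mB)).
  rewrite /m2 /= /pushforward.
  have -> : resample n @^-1` box J B =
      box (rem n J) B `*` (if n \in J then B n else setT).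
    apply/seteqP; split => -[w t] /=; rewrite /resample.
      move=> H; split=> [i iJ|].
        have [ni|ni] := eqVneq i n; last first.
          by have := H i (mem_rem iJ); rewrite /= (negPf ni).
        by move: iJ; rewrite ni mem_rem_uniq// inE eqxx.
      by case: ifP => // nJ; have := H n nJ; rewrite eqxx.
    move=> [H1 H2] i iJ /=; case: eqP => [ni|/eqP ni]; last first.
      by apply: H1; rewrite mem_rem_uniq// inE ni.
    by move: H2; rewrite -ni iJ.
  rewrite product_measure1E; last 2 first.
  - exact: measurable_box.
  - by case: ifP.
  rewrite [X in (X * _)%E](hPbox _ _ (rem_uniq _ uJ) mB); case: ifP => nJ.
    by rewrite (big_rem n)//= muleC.
  by rewrite [X in (_ * X)%E](probability_setT (p n)) mule1 rem_id ?nJ.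
- by move=> _; apply: le_lt_trans (probability_le1 P measurableT) _; rewrite ltry.
Qed.

(** A set whose fibers in one coordinate of continuous law are countable is null. *)
Lemma null_of_countable_fibers n (A : set S) : measurable A ->
  (forall t, measurable ([set t] : set T)) -> (forall t, p n [set t] = 0%E) ->
  (forall w : S, countable [set t | A (resample n (w, t))]) ->
  P A = 0%E.
Proof.
move=> mA mset pn cA; rewrite (resample_law n mA) /product_measure1 /=.
rewrite integral0_eq// => w _ /=; apply: measure_countable0 => //.
rewrite (_ : xsection _ _ = [set t | A (resample n (w, t))])//.
by apply/seteqP; split => t; rewrite /xsection /= inE.
Qed.

End ProductMeasures.

(** * Eigenvalues almost surely avoid a given energy *)

Theorem theorem6p3 (R : realType) (a b : \bar R) (hab : (a < b)%E)
  (V : R -> R) (hV : locally_integrable (oint a b) V)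
  (I : set int) (x : I -> R) (hx : admissible_points a b x)
  (psia psib : R) (hpsia : 0 <= psia < pi) (hpsib : 0 <= psib < pi)
  (hleft : forall (Lambda : I -> R) (Rho : I -> {posnum R}) (Theta : I -> R),
     regular_left a b V x \/ limit_point_case_left a b V x Lambda Rho Theta)
  (hright : forall (Lambda : I -> R) (Rho : I -> {posnum R}) (Theta : I -> R),
     regular_right a b V x \/ limit_point_case_right a b V x Lambda Rho Theta)
  (p1 : I -> probability (measurableTypeR R) R)
  (p2 : I -> probability (positive_reals R) R)
  (q : I -> probability (measurableTypeR R) R)
  (P1 : probability (sequence_space I (measurableTypeR R)) R)
  (P2 : probability (sequence_space I (positive_reals R)) R)
  (P3 : probability (sequence_space I (measurableTypeR R)) R)
  (hP1 : is_product_probability p1 P1)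
  (hP2 : is_product_probability p2 P2)
  (hP3 : is_product_probability q P3)
  (hq : exists n0 : I, continuous_measure (q n0))
  (E : R) :
  let PE : set (sequence_space I (measurableTypeR R) *
                sequence_space I (positive_reals R) *
                sequence_space I (measurableTypeR R))%type :=
    [set w | H_point_spectrum a b V x psia psib w.1.1 w.1.2 w.2 E%:C] in
  measurable PE ->
  ((P1 \x P2) \x P3)%E PE = 0%E.
Proof.
move=> PE mPE; have [n0 qn0] := hq.
apply: integral0_eq => -[Lambda Rho] _ /=.
have mS := measurable_xsection (Lambda, Rho) mPE.
apply: (@null_of_countable_fibers R I _ (measurableTypeR R) q P3 hP3 n0 _ mS
  (@measurable_set1 R) qn0).
move=> Theta.
set Z := [set t | _].
have [[t0 Zt0]|Z0] := pselect (Z !=set0); last first.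
  rewrite (_ : Z = set0); first exact: countable0.
  by apply/eqP/negPn/negP => /set0P.
apply: sub_countable (countable_sin_zeros t0).
apply: subset_card_le => t Zt /=.
have HE s : Z s -> H_point_spectrum a b V x psia psib Lambda Rho
    (resample n0 (Theta, s)) E%:C.
  by rewrite /Z /= /xsection /= inE.
have := @eigenvalue_angle _ V E a b I x psia psib hV hx Lambda Rho
  (resample n0 (Theta, t0)) (resample n0 (Theta, t)) n0 _ (hleft _ _ _) (hright _ _ _)
  (HE _ Zt0) (HE _ Zt).
rewrite /resample /= eqxx; apply => n /negPf nn.
by rewrite nn.
Qed.
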